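(* For each $m\ge 1$, let $T^{(m)}_{AB_1\cdots B_m}$ be the Choi matrix of a channel $\mathcal T^{(m)}:\mathcal B(\mathbb H_A)\to\mathcal B(\mathbb H_{B_1}\otimes\cdots\otimes\mathbb H_{B_m})$ (a $1\to m$ coherent quantum inference protocol) that is exchange-invariant or bosonic on its $m$ outputs. Assume that the marginal Choi matrices $T^{(m)}_{AB_1}=\operatorname{Tr}_{B_2\cdots B_m}T^{(m)}_{AB_1\cdots B_m}$ converge in trace norm, as $m\to\infty$, to the Choi matrix $\widetilde T_{AB_1}$ of a channel $\widetilde{\mathcal T}_{AB_1}:\mathcal B(\mathbb H_A)\to\mathcal B(\mathbb H_{B_1})$. If the loss $L$ is well behaved, then: 1. $\widetilde{\mathcal T}_{AB_1}$ is an entanglement-breaking channel; 2. $\widetilde{\mathcal T}_{AB_1}$ attains the limiting one-site risk, i.e., both for the worst-case risk ($\bullet=\mathrm w$) and for the average risk ($\bullet=\mathrm a$), $$\mathcal L_{\bullet}\bigl(\widetilde{\mathcal T}_{AB_1}\bigr)=\lim_{m\to\infty}\mathcal L_{\bullet,\mathrm{one}}\bigl(\mathcal T^{(m)}\bigr).$$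
   Context: All Hilbert spaces are finite dimensional: $\mathbb H_A=\mathbb C^{d_A}$ and $\mathbb H_{B_i}\cong\mathbb C^{d_B}$ for all $i$, with $d_A,d_B$ fixed. The Choi matrix of a channel (completely positive trace-preserving map) $\mathcal T:\mathcal B(\mathbb H_A)\to\mathcal B(\mathbb H_B)$ is $T_{AB}=\sum_{i,j}|i\rangle\langle j|_A\otimes\mathcal T(|i\rangle\langle j|)$, so $T_{AB}\ge0$ and $\operatorname{Tr}_BT_{AB}=I_A$. A $1\to m$ protocol is exchange-invariant on its outputs if $T_{AB_1\cdots B_m}$ is invariant under conjugation by every permutation unitary of $B_1,\dots,B_m$; it is bosonic if its output is supported on the totally symmetric subspace of $\mathbb H_{B}^{\otimes m}$. A channel is entanglement-breaking iff its Choi matrix is separable across the input-output cut. Inference task: $\mathcal X$ is a set of density operators on $\mathbb H_A$ (with a prior probability measure $\pi$ on it for average risks), $\gamma(\Sigma)$ is a target density operator on $\mathbb C^{d_B}$ for each $\Sigma\in\mathcal X$, and $L(\cdot,\cdot)$ is a real-valued loss function. $L$ is well behaved if there is a constant $L_0$ such that $|L(\gamma(\Sigma),\tau)-L(\gamma(\Sigma),\tau')|\le L_0\|\tau-\tau'\|_1$ for all $\Sigma\in\mathcal X$ and all density operators $\tau,\tau'$. For a single-output channel $\mathcal S$: $\mathcal L_{\mathrm w}(\mathcal S)=\sup_{\Sigma\in\mathcal X}L(\gamma(\Sigma),\mathcal S(\Sigma))$ and $\mathcal L_{\mathrm a}(\mathcal S)=\int_{\mathcal X}L(\gamma(\Sigma),\mathcal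 S(\Sigma))\,d\pi(\Sigma)$. For an $m$-output channel $\mathcal T$ the one-site risks are $\mathcal L_{\mathrm w,\mathrm{one}}(\mathcal T)=\sup_{\Sigma\in\mathcal X}\min_iL(\gamma(\Sigma),\mathcal T(\Sigma)_{B_i})$ and $\mathcal L_{\mathrm a,\mathrm{one}}(\mathcal T)=\int_{\mathcal X}\frac1m\sum_{i=1}^mL(\gamma(\Sigma),\mathcal T(\Sigma)_{B_i})\,d\pi(\Sigma)$, where $\mathcal T(\Sigma)_{B_i}$ is the marginal of the output on $B_i$ (for exchange-invariant or bosonic protocols all these marginals coincide). *)

(* Defs.v *)
From HB Require Import structures.
From mathcomp Require Import all_boot all_order all_algebra all_fingroup.
From mathcomp Require Import spectral sesquilinear.
From mathcomp Require Import all_classical all_reals all_analysis.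
From mathcomp Require Import complex mxtens.
Set Implicit Arguments.
Unset Strict Implicit.
Unset Printing Implicit Defensive.
Import Order.TTheory GRing.Theory Num.Theory.
Import numFieldNormedType.Exports.
Local Open Scope classical_set_scope.
Local Open Scope sesquilinear_scope.
Local Open Scope ring_scope.

(* Measurable types are pointed types. *)
HB.instance Definition _ (R : rcfType) := isPointed.Build R[i] 0.

Section Operators.
Variable R : realType.
Local Notation C := R[i].

(* In the order of R[i], 0 <= z means that z is a nonnegative real number, so
   this condition forces P to be Hermitian. *)
Definition psd n (P : 'M[C]_n) : Prop :=
  forall v : 'cV[C]_n, 0 <= (v^t* *m P *m v) 0 0.

Definition density n (rho : 'M[C]_n) : Prop := psd rho /\ \tr rho = 1.

(* ||A||_1 = Tr sqrt(A^* A), the sum of the singular values of A. *)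
Definition trnorm n (A : 'M[C]_n) : R :=
  complex.Re (\sum_(k < n) sqrtC (spectral_diag (A^t* *m A) 0 k)).

(* id_k (x) F on operators on C^k (x) C^n, the matrices of size k * n being read
   as k x k block matrices with n x n blocks. *)
Definition idtens k n p (F : 'M[C]_n -> 'M[C]_p) (X : 'M[C]_(k * n)) :
    'M[C]_(k * p) :=
  \sum_(i < k) \sum_(j < k)
    delta_mx i j *t
      F (\matrix_(a, b) X (mxtens_index (i, a)) (mxtens_index (j, b))).

Definition completely_positive n p (F : 'M[C]_n -> 'M[C]_p) : Prop :=
  forall k (X : 'M[C]_(k * n)), psd X -> psd (idtens F X).

Definition trace_preserving n p (F : 'M[C]_n -> 'M[C]_p) : Prop :=
  forall X, \tr (F X) = \tr X.

Definition is_channel n p (F : {linear 'M[C]_n -> 'M[C]_p}) : Prop :=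
  completely_positive F /\ trace_preserving F.

Definition choi n p (F : 'M[C]_n -> 'M[C]_p) : 'M[C]_(n * p) :=
  \sum_(i < n) \sum_(j < n) delta_mx i j *t F (delta_mx i j).

(* Unnormalized separability: the weights are absorbed in the product terms. *)
Definition separable n p (M : 'M[C]_(n * p)) : Prop :=
  exists (r : nat) (P : 'I_r -> 'M[C]_n) (Q : 'I_r -> 'M[C]_p),
    [/\ forall k, psd (P k), forall k, psd (Q k)
      & M = \sum_(k < r) P k *t Q k].

Definition entanglement_breaking n p (F : {linear 'M[C]_n -> 'M[C]_p}) : Prop :=
  is_channel F /\ separable (choi F).

End Operators.

(* The dimension of (C^dB)^{(x) m}. The computational basis vectors
   |f 0, ..., f (m-1)> are indexed by the functions f : 'I_m -> 'I_dB, through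
   enum_rank and enum_val. *)
Definition powdim (m dB : nat) : nat := #|{ffun 'I_m -> 'I_dB}|.

Section Outputs.
Variable R : realType.
Local Notation C := R[i].
Variables m dB : nat.

(* |f> |-> |f o s^-1>, which permutes the tensor factors. *)
Definition perm_unitary (s : 'S_m) : 'M[C]_(powdim m dB) :=
  \matrix_(a, b)
    (enum_val b == [ffun i => (enum_val a : {ffun 'I_m -> 'I_dB}) (s i)])%:R.

(* The partial trace over all the tensor factors but the i-th one. *)
Definition marginal (i : 'I_m) (X : 'M[C]_(powdim m dB)) : 'M[C]_dB :=
  \matrix_(x, y)
    \sum_(f : {ffun 'I_m -> 'I_dB} | f i == x)
      \sum_(g : {ffun 'I_m -> 'I_dB} |
              (g i == y) && [forall j, (j != i) ==> (f j == g j)])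
        X (enum_rank f) (enum_rank g).

Definition symmetric_vector (psi : 'cV[C]_(powdim m dB)) : Prop :=
  forall s : 'S_m, perm_unitary s *m psi = psi.

Variable dA : nat.
Implicit Type T : {linear 'M[C]_dA -> 'M[C]_(powdim m dB)}.

Definition exchange_invariant T : Prop :=
  forall s : 'S_m,
    let U : 'M[C]_(dA * powdim m dB) := 1%:M *t perm_unitary s in
    U *m choi T *m U^t* = choi T.

(* The support of T Sigma, i.e. its range, lies in the symmetric subspace. *)
Definition bosonic T : Prop :=
  forall Sigma, density Sigma ->
    forall psi : 'cV[C]_(powdim m dB), symmetric_vector (T Sigma *m psi).

End Outputs.

Section Risks.
Variable R : realType.
Local Notation C := R[i].
Variables dA dB : nat.
Variables (X : set 'M[C]_dA) (gamma : 'M[C]_dA -> 'M[C]_dB).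
Variable L : 'M[C]_dB -> 'M[C]_dB -> R.

Definition well_behaved : Prop :=
  exists L0 : R, forall Sigma tau tau',
    X Sigma -> density tau -> density tau' ->
    `|L (gamma Sigma) tau - L (gamma Sigma) tau'| <= L0 * trnorm (tau - tau').

(* Risks are extended real numbers: the supremum of an unbounded loss is +oo. *)
Definition worst_risk (S : 'M[C]_dA -> 'M[C]_dB) : \bar R :=
  ereal_sup [set (L (gamma Sigma) (S Sigma))%:E | Sigma in X].

Definition worst_one_risk m (T : 'M[C]_dA -> 'M[C]_(powdim m.+1 dB)) : \bar R :=
  ereal_sup
    [set (\big[Num.min/L (gamma Sigma) (marginal ord0 (T Sigma))]_(i < m.+1)
            L (gamma Sigma) (marginal i (T Sigma)))%:E | Sigma in X].

(* A prior on X, for an arbitrary sigma-algebra on X, is a probability measure pi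
   on an arbitrary sigma-algebra <<s G >> of sets of matrices with X measurable
   and pi X = 1. *)
Variables (G : set (set 'M[C]_dA)) (pi : probability (g_sigma_algebraType G) R).

Definition average_risk (S : 'M[C]_dA -> 'M[C]_dB) : \bar R :=
  (\int[pi]_(Sigma in X) (L (gamma Sigma) (S Sigma))%:E)%E.

Definition average_one_risk m (T : 'M[C]_dA -> 'M[C]_(powdim m.+1 dB)) :
    \bar R :=
  (\int[pi]_(Sigma in X)
     (m.+1%:R^-1 *
        \sum_(i < m.+1) L (gamma Sigma) (marginal i (T Sigma)))%:E)%E.

End Risks.

(* Main.v *)
Require Import Defs.
From HB Require Import structures.
From mathcomp Require Import all_boot all_order all_algebra all_fingroup.
From mathcomp Require Import spectral sesquilinear.
From mathcomp Require Import all_classical all_reals all_analysis.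
From mathcomp Require Import measurable_realfun.
From mathcomp Require Import complex mxtens.
From mathcomp Require Import ring lra.
Set Implicit Arguments.
Unset Strict Implicit.
Unset Printing Implicit Defensive.
Import Order.TTheory GRing.Theory Num.Theory.
Import numFieldNormedType.Exports.
Local Open Scope classical_set_scope.
Local Open Scope sesquilinear_scope.
Local Open Scope ring_scope.

(* That the limit channel is entanglement-breaking is a de Finetti argument by
   conditioning. Measure k of the outputs with a fixed informationally complete
   POVM. The state of A conditioned on the outcomes is a bounded matrix-valued
   martingale in k, so the sum over k of its squared increments is bounded and
   for some k < m one more measurement changes it by O(1 / sqrt m) on average.
   As the measurement determines the measured state, A and the next output are
   then nearly in a product state given the k outcomes. Averaging over the
   outcomes, the marginal on A and one output, which by exchange invariance is
   the same for all outputs, is within O(1 / sqrt m) of a separable operator.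
   Separable operators form a closed cone: Caratheodory's theorem bounds the
   number of product terms, which may be normalized to stay in a compact set.

   For the risks, exchange invariance makes all the one-site marginals equal,
   and the Choi matrices control the outputs uniformly over density operators,
   so that the one-site losses converge uniformly on X; suprema and (lower)
   integrals against a probability are continuous for uniform convergence. *)

(** * Positive semidefinite matrices *)

Section PositiveMatrices.
Variable R : realType.
Local Notation C := R[i].

Lemma trmxC_mul m n p (A : 'M[C]_(m, n)) (B : 'M[C]_(n, p)) :
  (A *m B)^t* = B^t* *m A^t*.
Proof. by rewrite trmx_mul map_mxM. Qed.

Lemma trmxCD m n (A B : 'M[C]_(m, n)) : (A + B)^t* = A^t* + B^t*.
Proof. by rewrite linearD /= map_mxD. Qed.

Lemma trmxCZ m n c (A : 'M[C]_(m, n)) : (c *: A)^t* = c^* *: A^t*.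
Proof. by rewrite linearZ /= map_mxZ. Qed.

Lemma trmxC_delta m n (i : 'I_m) (j : 'I_n) :
  (delta_mx i j : 'M[C]_(m, n))^t* = delta_mx j i.
Proof. by rewrite trmx_delta map_delta_mx. Qed.

Lemma delta_form m n (A : 'M[C]_(m, n)) i j :
  ((delta_mx i 0 : 'cV[C]_m)^t* *m A *m (delta_mx j 0 : 'cV[C]_n)) 0 0 = A i j.
Proof. by rewrite trmxC_delta -rowE -colE !mxE. Qed.

Lemma psd_gram m n (D : 'M[C]_(m, n)) : psd (D^t* *m D).
Proof.
move=> v; rewrite mulmxA -trmxC_mul -mulmxA mxE sumr_ge0 // => i _.
by rewrite !mxE mulrC mul_conjC_ge0.
Qed.

Lemma psd0 n : psd (0 : 'M[C]_n).
Proof. by move=> v; rewrite mulmx0 mul0mx mxE. Qed.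

Lemma psd1 n : psd (1%:M : 'M[C]_n).
Proof. by move=> v; have := @psd_gram n n 1%:M v; rewrite mulmx1 trmx1 map_mx1. Qed.

Lemma psd_proj n (v : 'cV[C]_n) : psd (v *m v^t*).
Proof. by have := psd_gram (v^t*); rewrite trmxCK. Qed.

Lemma psdZ n c (P : 'M[C]_n) : 0 <= c -> psd P -> psd (c *: P).
Proof.
by move=> c0 psdP v; rewrite -scalemxAr -scalemxAl mxE mulr_ge0.
Qed.

Lemma psd_form_real n (P : 'M[C]_n) (v : 'cV[C]_n) :
  psd P -> ((v^t* *m P *m v) 0 0)^* = (v^t* *m P *m v) 0 0.
Proof. by move=> psdP; apply/CrealP/ger0_real. Qed.

Lemma form_delta2 n (P : 'M[C]_n) c i j :
  let v : 'cV[C]_n := delta_mx i 0 + c *: delta_mx j 0 in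
  (v^t* *m P *m v) 0 0 = P i i + c * P i j + c^* * P j i + c^* * c * P j j.
Proof.
have bilin (a b : 'rV[C]_n) (e f : 'cV[C]_n) x y :
    ((a + x *: b) *m P *m (e + y *: f)) 0 0 = (a *m P *m e) 0 0
      + y * (a *m P *m f) 0 0 + x * (b *m P *m e) 0 0 + x * y * (b *m P *m f) 0 0.
  rewrite 2!mulmxDl 2!mulmxDr -!scalemxAl -!scalemxAr -?scalemxAl !mxE.
  by rewrite !(mulrA, addrA).
by rewrite /= trmxCD trmxCZ bilin 4!delta_form.
Qed.

(** The form is real at the vectors e_i + c e_j. Taking c = 1 and c = i gives two linear equations
    in [w^* - z] and [z^* - w], whose only solution is zero. *)
Lemma psd_hermitian n (P : 'M[C]_n) : psd P -> P^t* = P.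
Proof.
move=> psdP.
have diag i : (P i i)^* = P i i.
  by rewrite -(delta_form P i i); apply: psd_form_real.
apply/matrixP=> i j; rewrite !mxE.
have real2 c := psd_form_real (delta_mx i 0 + c *: delta_mx j 0) psdP.
have {}real2 c : (P i i + c * P i j + c^* * P j i + c^* * c * P j j)^*
    = P i i + c * P i j + c^* * P j i + c^* * c * P j j.
  by have := real2 c; rewrite form_delta2.
have := real2 1; have := real2 'i.
rewrite !rmorphD !rmorphM rmorph1 /= !conjCK conjCi !diag.
set z := P i j; set w := P j i => h1 h2.
have {}h1 : 'i * (w^* - z) - 'i * (z^* - w) = 0.
  by move/eqP: h1; rewrite -subr_eq0 => /eqP h1; rewrite -[RHS]h1; ring.
have {}h2 : (w^* - z) + (z^* - w) = 0.
  by move/eqP: h2; rewrite -subr_eq0 => /eqP h2; rewrite -[RHS]h2; ring.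
have : 2 * 'i * (w^* - z) = 0.
  by rewrite -[RHS]h1 -[LHS]subr0 -(mulr0 'i) -h2; ring.
by move/eqP; rewrite !mulf_eq0 pnatr_eq0 (negPf (neq0Ci _)) subr_eq0 => /eqP.
Qed.

Lemma psd_spectral n (P : 'M[C]_n) : psd P ->
  let U := spectralmx P in let sp := spectral_diag P in
  [/\ U *m U^t* = 1%:M, P = U^t* *m diag_mx sp *m U & forall k, 0 <= sp 0 k].
Proof.
move=> psdP U sp.
have U1 : U *m U^t* = 1%:M by apply/unitarymxP/spectral_unitarymx.
have PE : P = U^t* *m diag_mx sp *m U.
  have /orthomx_spectralP : P \is normalmx.
    by apply/normalmxP; rewrite psd_hermitian.
  by rewrite invmx_unitary ?spectral_unitarymx.
split=> // k; have := psdP (U^t* *m delta_mx k 0).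
rewrite {1}PE trmxC_mul trmxCK !mulmxA.
rewrite -[_ *m U *m U^t*]mulmxA U1 mulmx1 -[_ *m U *m U^t*]mulmxA U1 mulmx1.
by rewrite delta_form mxE eqxx mulr1n.
Qed.

Lemma psd_factor n (P : 'M[C]_n) : psd P -> exists D : 'M[C]_n, P = D^t* *m D.
Proof.
move=> /psd_spectral[]; move: (spectralmx P) (spectral_diag P) => U sp _ -> sp_ge0.
have <- : (diag_mx (map_mx sqrtC sp))^t* *m diag_mx (map_mx sqrtC sp)
    = diag_mx sp.
  rewrite tr_diag_mx map_diag_mx mulmx_diag; congr diag_mx.
  apply/rowP=> k; rewrite !mxE /= geC0_conj ?sqrtC_ge0 //.
  by rewrite -expr2 sqrtCK.
move: (diag_mx _) => D; exists (D *m U).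
by rewrite trmxC_mul !mulmxA.
Qed.

(** With Q = D* D, cyclicity turns the trace into that of D P D*, whose diagonal entries are values
    of the form of P. *)
Lemma psd_mxtrace_mul n (P Q : 'M[C]_n) : psd P -> psd Q -> 0 <= \tr (P *m Q).
Proof.
move=> psdP /psd_factor[D ->].
rewrite mulmxA mxtrace_mulC mulmxA; apply: sumr_ge0 => i _.
have := psdP (D^t* *m delta_mx i 0); rewrite trmxC_mul trmxCK.
by rewrite -(delta_form (D *m P *m D^t*)) !mulmxA.
Qed.

Lemma psd_mxtrace n (P : 'M[C]_n) : psd P -> 0 <= \tr P.
Proof.
by move=> psdP; have := psd_mxtrace_mul psdP (@psd1 n); rewrite mulmx1.
Qed.

Lemma psd_diag n (P : 'M[C]_n) i : psd P -> 0 <= P i i.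
Proof. by move=> psdP; rewrite -(delta_form P). Qed.

Lemma psd_diag_le n (P : 'M[C]_n) i : psd P -> P i i <= \tr P.
Proof.
by move=> psdP; rewrite /mxtrace (bigD1 i) //= lerDl sumr_ge0 // => j _;
  apply: psd_diag.
Qed.

(** Positivity at e_i + c e_j for c among 1, -1, i, -i bounds twice the real or imaginary part of
    [P i j] by [P i i + P j j]. *)
Lemma psd_entry n (P : 'M[C]_n) i j : psd P ->
  `|complex.Re (P i j)| <= complex.Re (\tr P) /\
  `|complex.Im (P i j)| <= complex.Re (\tr P).
Proof.
move=> psdP.
have Pji : P j i = (P i j)^* by rewrite -{1}(psd_hermitian psdP) !mxE.
have trP := psd_mxtrace psdP.
have diag2 : complex.Re (P i i) + complex.Re (P j j) <= 2 * complex.Re (\tr P).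
  have := psd_diag_le i psdP; have := psd_diag_le j psdP.
  rewrite !lecE => /andP[_ h1] /andP[_ h2]; lra.
have test (c : C) : 0 <= P i i + c * P i j + c^* * (P i j)^* + c^* * c * P j j.
  by rewrite -Pji -form_delta2; apply: psdP.
have := test 1; have := test (-1); have := test 'i%C; have := test (- 'i%C).
move: diag2; case: (P i j) (P i i) (P j j) (\tr P) trP => a b [c d] [c' d'] [t t'].
rewrite !lecE /= => _ h /andP[_ h1] /andP[_ h2] /andP[_ h3] /andP[_ h4].
by rewrite !ler_norml; split; apply/andP; split; lra.
Qed.

Lemma psd_tr0 n (P : 'M[C]_n) : psd P -> \tr P = 0 -> P = 0.
Proof.
move=> psdP tr0; apply/matrixP=> i j; have [] := psd_entry i j psdP.
rewrite tr0 !normr_le0 mxE => /eqP h1 /eqP h2.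
by rewrite [LHS]complexE h1 h2 mulr0 addr0.
Qed.

End PositiveMatrices.

(** * Trace norm compared with entrywise bounds *)

Section TraceNorm.
Variable R : realType.
Local Notation C := R[i].
Local Open Scope complex_scope.

Lemma mxtrace_spectral n (P : 'M[C]_n) : psd P ->
  \tr P = \sum_k spectral_diag P 0 k.
Proof.
move=> /psd_spectral[U1 PE _]; rewrite {1}PE.
by rewrite mxtrace_mulC mulmxA U1 mul1mx mxtrace_diag.
Qed.

Lemma trnormE n (A : 'M[C]_n) :
  (trnorm A)%:C = \sum_(k < n) sqrtC (spectral_diag (A^t* *m A) 0 k).
Proof.
have [_ _ sp_ge0] := psd_spectral (psd_gram A).
rewrite /trnorm RRe_real // ger0_real // sumr_ge0 // => k _.
by rewrite sqrtC_ge0.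
Qed.

Lemma trnorm_ge0 n (A : 'M[C]_n) : 0 <= trnorm A.
Proof.
have [_ _ sp_ge0] := psd_spectral (psd_gram A).
by rewrite -ler0c trnormE sumr_ge0 // => k _; rewrite sqrtC_ge0.
Qed.

Lemma gram_diag m n (A : 'M[C]_(m, n)) j :
  (A^t* *m A) j j = \sum_i `|A i j| ^+ 2.
Proof.
by rewrite mxE; apply: eq_bigr => i _; rewrite !mxE normCK mulrC.
Qed.

(** The squared modulus of an entry is at most Tr A*A, the sum of the squared singular values, hence
    at most the square of their sum. *)
Lemma trnorm_entry n (A : 'M[C]_n) i j : `|A i j| <= (trnorm A)%:C.
Proof.
have psdA := psd_gram A; have [_ _ sp_ge0] := psd_spectral psdA.
have s_ge0 k : 0 <= sqrtC (spectral_diag (A^t* *m A) 0 k) by rewrite sqrtC_ge0.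
rewrite trnormE; set S := \sum_k _; have S_ge0 : 0 <= S by rewrite sumr_ge0.
rewrite -(@ler_pXn2r _ 2) ?nnegrE //.
apply: (@le_trans _ _ (\tr (A^t* *m A))).
  apply: le_trans (psd_diag_le j psdA); rewrite gram_diag (bigD1 i) //=.
  by rewrite lerDl sumr_ge0 // => k _; rewrite exprn_ge0.
rewrite mxtrace_spectral // expr2 {1}/S mulr_suml ler_sum // => k _.
rewrite -{1}[spectral_diag _ _ _]sqrtCK expr2 ler_wpM2l //.
by rewrite /S (bigD1 k) //= lerDl sumr_ge0.
Qed.

(** Each of the n singular values has square at most Tr A*A, hence at most (n e)^2. *)
Lemma trnorm_le n (A : 'M[C]_n) (e : R) :
  (forall i j, `|A i j| <= e%:C) -> trnorm A <= n%:R * (n%:R * e).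
Proof.
move=> Ae; have psdA := psd_gram A; have [_ _ sp_ge0] := psd_spectral psdA.
rewrite -lecR trnormE !rmorphM /= !rmorph_nat.
rewrite mulr_natl -[X in _ *+ X](card_ord n) -sumr_const ler_sum // => k _.
have e_ge0 : 0 <= e%:C by apply: le_trans (Ae k k).
have ne_ge0 : 0 <= n%:R * e%:C by rewrite mulr_ge0.
rewrite -[leRHS](sqrCK ne_ge0) ler_sqrtC ?qualifE /= ?exprn_ge0 //.
apply: (@le_trans _ _ (\tr (A^t* *m A))).
  by rewrite mxtrace_spectral // (bigD1 k) //= lerDl sumr_ge0.
rewrite exprMn [n%:R ^+ 2]expr2 -mulrA.
rewrite mulr_natl -[X in _ *+ X](card_ord n) -sumr_const ler_sum // => j _.
rewrite gram_diag mulr_natl -[X in _ *+ X](card_ord n) -sumr_const.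
by rewrite ler_sum // => i _; rewrite ler_pXn2r ?nnegrE.
Qed.

End TraceNorm.

(** * Closedness of the separable cone *)

Section ComplexCoordinates.
Variable R : realType.
Local Notation C := R[i].
Local Open Scope complex_scope.

(** The two real coordinates share one name, so that linearity, bounds and limits are proved for
    both at once. *)
Definition reim (b : bool) (z : C) : R := if b then complex.Re z else complex.Im z.

Lemma reimD b z w : reim b (z + w) = reim b z + reim b w.
Proof. by case: b z w => [] [? ?] [? ?]. Qed.

Lemma reim0 b : reim b 0 = 0.
Proof. by case: b. Qed.

Lemma reimB b z w : reim b (z - w) = reim b z - reim b w.
Proof. by case: b z w => [] [? ?] [? ?]. Qed.

Lemma reim_sum b I r (Q : pred I) (F : I -> C) :
  reim b (\sum_(i <- r | Q i) F i) = \sum_(i <- r | Q i) reim b (F i).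
Proof. exact: (big_morph _ (reimD b) (reim0 b)). Qed.

Lemma reimZ b (a : R) z : reim b (a%:C * z) = a * reim b z.
Proof. by case: b z => [] [x y] /=; ring. Qed.

Lemma reim_inj z w : (forall b, reim b z = reim b w) -> z = w.
Proof.
by case: z w => [x y] [x' y'] zw; have := zw true; have /= -> := zw false => /= ->.
Qed.

Lemma reim_norm b (z : C) (e : R) : `|z| <= e%:C -> `|reim b z| <= e.
Proof.
rewrite normc_def lecR; apply: le_trans; rewrite -sqrtr_sqr ler_wsqrtr //.
by case: b; rewrite (lerDl, lerDr) sqr_ge0.
Qed.

Lemma norm_reim (z : C) (e f : R) :
  `|reim true z| <= e -> `|reim false z| <= f -> `|z| <= (e + f)%:C.
Proof.
case: z => x y /= xe yf; rewrite normc_def lecR /=.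
have e0 : 0 <= e by apply: le_trans xe.
have f0 : 0 <= f by apply: le_trans yf.
rewrite -[leRHS]ger0_norm ?addr_ge0 // -sqrtr_sqr ler_sqrt ?sqr_ge0 //.
rewrite -(real_normK (num_real x)) -(real_normK (num_real y)).
have := normr_ge0 x; have := normr_ge0 y; nra.
Qed.

End ComplexCoordinates.

(** * Complex limits along a filter, by real coordinates *)

Section ComplexLimits.
Variable R : realType.
Local Notation C := R[i].
Variables (T : Type) (F : set_system T).
Context {FF : ProperFilter F}.

Definition ccvg (z : T -> C) (l : C) : Prop :=
  forall b, reim b (z t) @[t --> F] --> reim b l.

Lemma ccvg_cst c : ccvg (fun=> c) c.
Proof. by move=> b; apply: cvg_cst. Qed.

Lemma ccvgD z w l k : ccvg z l -> ccvg w k -> ccvg (fun t => z t + w t) (l + k).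
Proof.
move=> zl wk b; rewrite reimD; under eq_fun do rewrite reimD.
exact: cvgD.
Qed.

Lemma ccvgM z w l k : ccvg z l -> ccvg w k -> ccvg (fun t => z t * w t) (l * k).
Proof.
have mulE b (x y : C) : reim b (x * y) = if b
    then reim true x * reim true y - reim false x * reim false y
    else reim true x * reim false y + reim false x * reim true y.
  by case: b x y => [] [? ?] [? ?].
move=> zl wk b; rewrite mulE; under eq_fun do rewrite mulE.
by case: b; [apply: cvgB | apply: cvgD]; apply: cvgM.
Qed.

Lemma ccvg_sum I (r : seq I) (z : I -> T -> C) (l : I -> C) :
  (forall i, ccvg (z i) (l i)) ->
  ccvg (fun t => \sum_(i <- r) z i t) (\sum_(i <- r) l i).
Proof.
move=> zl; elim: r => [|i r IHr].
  by rewrite big_nil; under eq_fun do rewrite big_nil; apply: ccvg_cst.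
by rewrite big_cons; under eq_fun do rewrite big_cons; apply: ccvgD.
Qed.

Lemma ccvg_ge0 z l : ccvg z l -> (forall t, 0 <= z t) -> 0 <= l.
Proof.
move=> zl z_ge0; rewrite lecE; apply/andP; split; last first.
  rewrite -[leRHS](cvg_lim (@norm_hausdorff _ R^o) (zl true)).
  apply: limr_ge; first by apply/cvg_ex; exists (reim true l); apply: zl.
  by apply: nearW => t; have := z_ge0 t; rewrite lecE => /andP[].
apply/eqP/(cvg_unique (@norm_hausdorff _ R^o) (zl false)) => /=.
rewrite (_ : (fun t => _) = fun=> 0); first exact: cvg_cst.
by apply/funext => t; have := z_ge0 t; rewrite lecE => /andP[/eqP].
Qed.

Lemma ccvg_unique z l k : ccvg z l -> ccvg z k -> l = k.
Proof. by move=> zl zk; apply: reim_inj => b; apply: (cvg_unique (@norm_hausdorff _ R^o) (zl b) (zk b)). Qed.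

End ComplexLimits.

Lemma psd_lim (R : realType) T (F : set_system T) (FF : ProperFilter F) n
    (P : T -> 'M[R[i]]_n) (Q : 'M[R[i]]_n) :
  (forall i j, ccvg F (fun t => P t i j) (Q i j)) ->
  (forall t, psd (P t)) -> psd Q.
Proof.
move=> PQ psdP v.
apply: (@ccvg_ge0 R T F FF (fun t => (v^t* *m P t *m v) 0 0)) => [|t]; last exact: psdP.
rewrite mxE; under [X in ccvg _ X]eq_fun do rewrite mxE.
apply: ccvg_sum => j; apply: ccvgM; last exact: ccvg_cst.
rewrite mxE; under [X in ccvg _ X]eq_fun do rewrite mxE.
by apply: ccvg_sum => k; apply: ccvgM; first exact: ccvg_cst.
Qed.

(** The image of an ultrafilter is an ultrafilter, so it converges in the compact segment [[-K, K]].
    This replaces the extraction of subsequences. *)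
Lemma ultra_bounded_ccvg (R : realType) T (F : set_system T)
    (FF : UltraFilter F) (z : T -> R[i]) (K : R) :
  (forall t b, `|reim b (z t)| <= K) -> exists l, ccvg F z l.
Proof.
move=> zK; have lim b : exists l : R, reim b (z t) @[t --> F] --> l.
  have := @segment_compact R (- K) K; rewrite compact_ultra.
  move=> /(_ (fmap (fun t => reim b (z t)) F))[].
  - split; first exact: fmap_proper_filter.
    move=> G PG sG; apply/seteqP; split=> // A GA.
    have [//|FA] := in_ultra_setVsetC ((fun t => reim b (z t)) @^-1` A) FF.
    have := filterI GA (sG (~` A) FA); rewrite setICr => G0.
    by case: (filter_not_empty G (G0 _)).
  - apply: (@filterS _ F _ setT) filterT => t _ /=.
    by rewrite in_itv /= -ler_norml.
  - by move=> l [_ ?]; exists l.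
have [[x hx] [y hy]] := (lim true, lim false).
by exists (Complex x y) => -[].
Qed.

(** More vectors than coordinates are dependent. Up to a global sign some coefficient is positive,
    hence so is the largest one. *)
Lemma real_dependency (R : realFieldType) r N (B : 'M[R]_(r, N)) : (N < r)%N ->
  exists c : 'rV[R]_r,
    c *m B = 0 /\ exists2 j, 0 < c 0 j & forall k, c 0 k <= c 0 j.
Proof.
move=> Nr; have /rowV0Pn[c /sub_kermxP cB c0] : kermx B != 0.
  by rewrite kermx_eq0 -row_leq_rank -ltnNge (leq_ltn_trans (rank_leq_col B)).
have [j cj] : exists j, c 0 j != 0.
  apply/existsP; apply: contraR c0; rewrite negb_exists => /forallP h.
  by apply/eqP/rowP=> j; rewrite mxE; apply/eqP; have := h j; rewrite negbK.
wlog cj0 : c cB {c0} cj / 0 < c 0 j.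
  move=> main; have := cj; rewrite neq_lt => /orP[cj0|cj0]; last exact: main cj0.
  by apply: (main (- c)); rewrite ?mulNmx ?cB ?oppr0 // !mxE ?oppr_eq0 ?oppr_gt0.
exists c; split=> //.
case: (@arg_maxP _ _ _ j xpredT (c 0)) => // k _ ck.
by exists k => [|i]; [apply: lt_le_trans cj0 (ck j _) | apply: ck].
Qed.

Section Separable.
Variables (R : realType) (n p : nat).
Local Notation C := R[i].
Local Open Scope complex_scope.
Implicit Types M : 'M[C]_(n * p).

Definition product_sum r M : Prop :=
  exists (P : 'I_r -> 'M[C]_n) (Q : 'I_r -> 'M[C]_p),
    [/\ forall k, psd (P k), forall k, psd (Q k)
      & M = \sum_(k < r) P k *t Q k].

Lemma tensmxZl m1 n1 m2 n2 c (A : 'M[C]_(m1, n1)) (B : 'M[C]_(m2, n2)) :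
  (c *: A) *t B = c *: (A *t B).
Proof. by apply/matrixP => i j; rewrite !mxE mulrA. Qed.

Lemma tensmxZr m1 n1 m2 n2 c (A : 'M[C]_(m1, n1)) (B : 'M[C]_(m2, n2)) :
  A *t (c *: B) = c *: (A *t B).
Proof. by apply/matrixP => i j; rewrite !mxE mulrCA. Qed.

Lemma mxtrace_tens (P : 'M[C]_n) (Q : 'M[C]_p) : \tr (P *t Q) = \tr P * \tr Q.
Proof. by rewrite /mxtrace mulr_sum; apply: eq_bigr => i _; rewrite mxE. Qed.

Lemma separable_sum (I : finType) (P : I -> 'M[C]_n) (Q : I -> 'M[C]_p) :
  (forall i, psd (P i)) -> (forall i, psd (Q i)) ->
  separable (\sum_i P i *t Q i).
Proof.
move=> psdP psdQ.
exists #|I|, (fun k => P (enum_val k)), (fun k => Q (enum_val k)); split=> //.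
by rewrite (reindex _ (onW_bij _ (@enum_val_bij I))).
Qed.

(* The real dimension of the space of matrices M. *)
Let N := #|{: bool * 'I_(n * p) * 'I_(n * p)}|.

(* Caratheodory: a real dependency c among the terms, scaled so that its
   largest coefficient is 1, allows one to lower the weights 1 to 1 - c k and
   thus to cancel a term. *)
Lemma product_sum_drop r M : (N < r.+1)%N -> product_sum r.+1 M -> product_sum r M.
Proof.
move=> Nr [P [Q [psdP psdQ ->]]].
pose B : 'M[R]_(r.+1, N) := \matrix_(k, l)
  let: (b, i, j) := enum_val l in reim b ((P k *t Q k) i j).
have [c [cB [j cj0 cj]]] := real_dependency B Nr.
have c_sum : \sum_k (c 0 k)%:C *: (P k *t Q k) = 0.
  apply/matrixP => a b; rewrite summxE mxE; apply: reim_inj => h.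
  rewrite reim_sum reim0; have /matrixP/(_ 0 (enum_rank (h, a, b))) := cB.
  rewrite !mxE => {2}<-; apply: eq_bigr => k _.
  by rewrite !mxE enum_rankK mxE reimZ.
pose w k : C := 1 - (c 0 k / c 0 j)%:C.
have w_ge0 k : 0 <= w k by rewrite subr_ge0 lecR ler_pdivrMr // mul1r.
exists (fun k => w (lift j k) *: P (lift j k)), (fun k => Q (lift j k)).
split=> [k|k|]; [exact: psdZ|exact: psdQ|].
have -> : \sum_(k < r.+1) P k *t Q k = \sum_(k < r.+1) (w k *: P k) *t Q k.
  transitivity (\sum_k P k *t Q k -
      (c 0 j)^-1%:C *: \sum_k (c 0 k)%:C *: (P k *t Q k)).
    by rewrite c_sum scaler0 subr0.
  rewrite scaler_sumr -sumrB; apply: eq_bigr => k _.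
  rewrite scalerA tensmxZl -{1}[P k *t Q k]scale1r -scalerBl.
  by congr (_ *: _); rewrite /w rmorphM /= [X in _ - X]mulrC.
rewrite (bigD1_ord j) //= /w divff ?gt_eqF // subrr.
by rewrite scale0r tens0mx add0r.
Qed.

Lemma product_sum_pad r M : product_sum r M -> product_sum r.+1 M.
Proof.
move=> [P [Q [psdP psdQ ->]]].
exists (fun k => oapp P 0 (unlift ord0 k)), (fun k => oapp Q 0 (unlift ord0 k)).
split=> [k|k|].
- by case: (unlift _ _) => [i|] /=; [exact: psdP | exact: psd0].
- by case: (unlift _ _) => [i|] /=; [exact: psdQ | exact: psd0].
rewrite big_ord_recl unlift_none /= tens0mx add0r.
by apply: eq_bigr => k _; rewrite liftK.
Qed.

Lemma separable_caratheodory M : separable M -> product_sum N M.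
Proof.
move=> [r [P [Q hM]]]; have {P Q hM} : product_sum r M by exists P, Q.
have [rN|/ltnW] := leqP r N.
  by rewrite -(subnK rN); elim: (N - r)%N => // d IHd /IHd/product_sum_pad.
move=> Nr; rewrite -(subnK Nr); elim: (r - N)%N => // d IHd.
by move=> /product_sum_drop h; apply/IHd/h; rewrite ltnS leq_addl.
Qed.

(** If [\tr Q = 0], its inverse is 0 by convention, but then [Q = 0] by [psd_tr0] and rescaling
    still gives back [Q]. *)
Lemma psd_normalize (Q : 'M[C]_p) : psd Q ->
  [/\ psd ((\tr Q)^-1 *: Q), complex.Re (\tr ((\tr Q)^-1 *: Q)) <= 1
    & \tr Q *: ((\tr Q)^-1 *: Q) = Q].
Proof.
move=> psdQ; have trQ := psd_mxtrace psdQ; split.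
- by apply: psdZ; rewrite ?invr_ge0.
- rewrite mxtraceZ; have [->|t0] := eqVneq (\tr Q) 0; first by rewrite mulr0 ler01.
  by rewrite mulVf.
- have [/(psd_tr0 psdQ)->|t0] := eqVneq (\tr Q) 0; first by rewrite !scaler0.
  by rewrite scalerA divff ?scale1r.
Qed.

(** The trace of each second factor is moved to the first. The trace of the new first factor is then
    one of the nonnegative terms that add up to [\tr M]. *)
Lemma product_sum_bounded r M : product_sum r M ->
  exists (P : 'I_r -> 'M[C]_n) (Q : 'I_r -> 'M[C]_p),
    [/\ forall k, psd (P k) /\ complex.Re (\tr (P k)) <= complex.Re (\tr M),
        forall k, psd (Q k) /\ complex.Re (\tr (Q k)) <= 1
      & M = \sum_(k < r) P k *t Q k].
Proof.
move=> [P [Q [psdP psdQ ->]]].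
exists (fun k => \tr (Q k) *: P k), (fun k => (\tr (Q k))^-1 *: Q k); split=> [k|k|].
- split; first by apply: psdZ (psd_mxtrace _) _.
  rewrite mxtraceZ mulrC -mxtrace_tens (bigD1 k) //= mxtraceD.
  have : 0 <= \tr (\sum_(i < r | i != k) P i *t Q i).
    rewrite raddf_sum; apply: sumr_ge0 => i _ /=.
    by rewrite mxtrace_tens mulr_ge0 // psd_mxtrace.
  by rewrite lecE -![complex.Re _]/(reim true _) reimD lerDl => /andP[].
- by have [] := psd_normalize (psdQ k).
- apply: eq_bigr => k _; have [_ _ {1}<-] := psd_normalize (psdQ k).
  by rewrite tensmxZl tensmxZr.
Qed.

Lemma separable_closed M :
  (forall e : R, 0 < e ->
     exists S, separable S /\ forall i j, `|M i j - S i j| <= e%:C) ->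
  separable M.
Proof.
(* An approximant within [harmonic m <= 1] of [M] entrywise has trace at most that of [M] plus one
   unit per diagonal entry, so [K] bounds its factors uniformly in [m]. *)
move=> Mlim; pose K := complex.Re (\tr M) + (n * p)%:R.
have approx m : exists PQ : ('I_N -> 'M[C]_n) * ('I_N -> 'M[C]_p),
    [/\ forall k, psd (PQ.1 k) /\ complex.Re (\tr (PQ.1 k)) <= K,
        forall k, psd (PQ.2 k) /\ complex.Re (\tr (PQ.2 k)) <= 1
      & forall i j, `|M i j - (\sum_(k < N) PQ.1 k *t PQ.2 k) i j| <= (harmonic m)%:C].
  have [S [/separable_caratheodory/product_sum_bounded[P [Q [hP hQ SE]]] MS]] :=
    Mlim (harmonic m) (harmonic_gt0 m).
  exists (P, Q); split=> [k||i j]; [|exact: hQ|by rewrite -SE].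
  have [? /le_trans leK] := hP k; split=> //; apply: leK.
  rewrite /K -lerBlDl -![complex.Re _]/(reim true _) -reimB.
  rewrite /mxtrace -sumrB reim_sum.
  rewrite -[X in _ <= X%:R](card_ord (n * p)) -sumr_const ler_sum // => i _.
  have := MS i i; rewrite distrC => /(reim_norm true) h.
  apply: le_trans (le_trans (ler_norm _) h) _.
  by rewrite /= invf_le1 ?ltr0n // ler1n.
have [PQ hPQ] := choice approx.
(* Along an ultrafilter finer than the neighbourhoods of infinity, all entries of all factors
   converge simultaneously. *)
have [U [UU subU]] := ultraFilterLemma (@eventually_filter).
have PU k i j : exists l, ccvg U (fun m => (PQ m).1 k i j) l.
  apply: (@ultra_bounded_ccvg R nat U UU _ K) => m b.
  have [/(_ k)[psdP leK] _ _] := hPQ m.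
  by have [h1 h2] := psd_entry i j psdP; case: b => /=; apply: le_trans leK.
have QU k i j : exists l, ccvg U (fun m => (PQ m).2 k i j) l.
  apply: (@ultra_bounded_ccvg R nat U UU _ 1) => m b.
  have [_ /(_ k)[psdQ leK] _] := hPQ m.
  by have [h1 h2] := psd_entry i j psdQ; case: b => /=; apply: le_trans leK.
have {PU} [P PU] : exists P : 'I_N -> 'M[C]_n,
    forall k i j, ccvg U (fun m => (PQ m).1 k i j) (P k i j).
  exists (fun k => \matrix_(i, j) projT1 (cid (PU k i j))) => k i j.
  by rewrite mxE; case: cid.
have {QU} [Q QU] : exists Q : 'I_N -> 'M[C]_p,
    forall k i j, ccvg U (fun m => (PQ m).2 k i j) (Q k i j).
  exists (fun k => \matrix_(i, j) projT1 (cid (QU k i j))) => k i j.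
  by rewrite mxE; case: cid.
exists N, P, Q; split=> [k|k|].
- apply: (psd_lim _ (PU k)) => m.
  by have [/(_ k)[]] := hPQ m.
- apply: (psd_lim _ (QU k)) => m.
  by have [_ /(_ k)[]] := hPQ m.
apply/matrixP => a b.
apply: (@ccvg_unique R nat U _ (fun m => (\sum_(k < N) (PQ m).1 k *t (PQ m).2 k) a b)).
  move=> h; apply: cvg_trans (_ : _ --> _); first by apply: cvg_app; exact: subU.
  apply/cvgrPdist_le => e e0.
  have /cvgrPdist_le/(_ e e0) := @cvg_harmonic R; apply: filterS => m.
  have [_ _ /(_ a b)/(reim_norm h)] := hPQ m.
  by rewrite reimB sub0r normrN => hm; apply: le_trans; apply: le_trans hm (ler_norm _).
rewrite summxE; under [X in ccvg _ X]eq_fun do rewrite summxE.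
apply: ccvg_sum => k; rewrite mxE; under [X in ccvg _ X]eq_fun do rewrite mxE.
exact: ccvgM.
Qed.

End Separable.

(** * Decoupling by measurement *)

Lemma big_tuple_rcons (V : nmodType) (Y : finType) k (F : seq Y -> V) :
  \sum_(t : k.+1.-tuple Y) F t = \sum_(t : k.-tuple Y) \sum_z F (rcons t z).
Proof.
rewrite pair_big /=.
pose f (tz : k.-tuple Y * Y) : k.+1.-tuple Y := [tuple of rcons tz.1 tz.2].
pose g (t : k.+1.-tuple Y) : k.-tuple Y * Y :=
  ([tuple of belast (thead t) (behead t)], last (thead t) (behead t)).
rewrite (reindex f) //=; exists g => [[t z]|t] _.
  rewrite /f /g /=; congr (_, _).
    by apply: val_inj; case: t => -[|a s] ? /=; rewrite ?belast_rcons.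
  by case: t => -[|a s] ? /=; rewrite ?last_rcons.
by apply: val_inj; rewrite /f /g /= -lastI; case: t => -[].
Qed.

Section Martingale.
Variables (R : realFieldType) (Y I : finType) (m : nat).
(** [p s] is the weight of the outcome string [s] and [x i s] a real coordinate of the unnormalized
    state given [s], so that [x i s / p s] is the martingale. Strings of weight 0 do no harm, since
    [x_le] makes [x] vanish there. *)
Variables (p : seq Y -> R) (x : I -> seq Y -> R).
Hypothesis p_split : forall s, (size s < m)%N -> \sum_z p (rcons s z) = p s.
Hypothesis x_split :
  forall i s, (size s < m)%N -> \sum_z x i (rcons s z) = x i s.
Hypothesis x_le : forall i s, `|x i s| <= p s.

Let p_ge0 s (i : I) : 0 <= p s.
Proof. exact: le_trans (x_le i s). Qed.

Let x0 i s : p s = 0 -> x i s = 0.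
Proof. by have := x_le i s => /[swap] ->; rewrite normr_le0 => /eqP. Qed.

(** The martingale increment from [s] to [rcons s z], multiplied by the weight of [rcons s z]. *)
Let dev i s z := x i (rcons s z) - x i s * p (rcons s z) / p s.
(** The square of the martingale at [s], multiplied by the weight of [s]. *)
Let pot i s := x i s ^+ 2 / p s.

Let pot_ge0 i s : 0 <= pot i s.
Proof. by rewrite /pot divr_ge0 ?sqr_ge0 ?p_ge0. Qed.

Let dev_p0 i s z : (size s < m)%N -> p (rcons s z) = 0 -> dev i s z = 0.
Proof. by move=> sm p0; rewrite /dev p0 mulr0 mul0r subr0 x0. Qed.

(** Orthogonality of martingale increments: the expected squared increment is the increase of the
    expected square, the cross term being evaluated by [x_split]. *)
Let pot_step i s : (size s < m)%N ->
  \sum_z dev i s z ^+ 2 / p (rcons s z) = \sum_z pot i (rcons s z) - pot i s.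
Proof.
move=> sm; transitivity (\sum_z (pot i (rcons s z)
    - 2 * x i s / p s * x i (rcons s z) + (x i s / p s) ^+ 2 * p (rcons s z))).
  apply: eq_bigr => z _; have [pz|pz] := eqVneq (p (rcons s z)) 0.
    by rewrite dev_p0 // /pot pz (x0 i pz); ring.
  have [ps|ps] := eqVneq (p s) 0; first by rewrite /dev /pot ps invr0; ring.
  by rewrite /dev /pot; field; rewrite pz ps.
rewrite big_split sumrB /= -!mulr_sumr x_split // p_split //.
have [ps|ps] := eqVneq (p s) 0; first by rewrite /pot ps invr0; ring.
by rewrite /pot; field.
Qed.

Let level k (F : seq Y -> R) := \sum_(t : k.-tuple Y) F t.

Let level_p k : (k <= m)%N -> level k p = p [::].
Proof.
elim: k => [_|k IHk km]; first by
  rewrite /level (big_pred1 [tuple]) // => t; rewrite (tuple0 t) /= eq_refl.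
rewrite -IHk; last exact: ltnW.
by rewrite /level big_tuple_rcons; apply: eq_bigr => t _; rewrite p_split ?size_tuple.
Qed.

Let total k := \sum_i level k (pot i).

Let total_le k : (k <= m)%N -> total k <= #|I|%:R * p [::].
Proof.
move=> km; rewrite mulr_natl -sumr_const ler_sum // => i _.
rewrite -(level_p km) ler_sum // => t _; rewrite /pot.
have [ps|ps] := eqVneq (p t) 0; first by rewrite ps invr0 mulr0.
rewrite ler_pdivrMr ?lt_def ?ps ?p_ge0 // -real_normK ?num_real // -expr2.
by rewrite ler_pXn2r ?nnegrE ?x_le ?p_ge0.
Qed.

Let total_step k : (k < m)%N ->
  \sum_i level k (fun s => \sum_z dev i s z ^+ 2 / p (rcons s z))
    = total k.+1 - total k.
Proof.
move=> km; rewrite /total -sumrB; apply: eq_bigr => i _.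
rewrite /level big_tuple_rcons -sumrB; apply: eq_bigr => t _.
by rewrite pot_step ?size_tuple.
Qed.

(** The increments of [total] telescope over [m] levels to at most [#|I|%:R * p [::]], so some level
    gets no more than its share. *)
Let good_level : (0 < m)%N -> exists2 k, (k < m)%N &
  m%:R * (total k.+1 - total k) <= #|I|%:R * p [::].
Proof.
move=> m0; have total0 : 0 <= total 0.
  by rewrite sumr_ge0 // => i _; rewrite sumr_ge0.
apply/not_exists2P => bad.
have : \sum_(k < m) (m%:R * (total k.+1 - total k)) <= m%:R * (#|I|%:R * p [::]).
  rewrite -mulr_sumr -(big_mkord xpredT (fun k => total k.+1 - total k)).
  rewrite telescope_sumr // ler_wpM2l //.
  by rewrite lerBlDr (le_trans (total_le (leqnn m))) // lerDl.
apply/negP; rewrite -ltNge mulr_natl -[X in _ *+ X]card_ord -sumr_const.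
apply: ltr_sum => [|k _]; first by apply/hasP; exists (Ordinal m0); rewrite ?mem_index_enum.
have [/negP|/negP] := bad k; first by rewrite ltn_ord.
by rewrite ltNge.
Qed.

(* AM-GM, |d| <= (delta p + d ^ 2 / (delta p)) / 2, replaces Cauchy-Schwarz. *)
Let dev_amgm i s z delta : (size s < m)%N -> 0 < delta ->
  `|dev i s z| <=
    (delta * p (rcons s z) + delta^-1 * (dev i s z ^+ 2 / p (rcons s z))) / 2.
Proof.
move=> sm d0; have [pz|pz] := eqVneq (p (rcons s z)) 0.
  by rewrite dev_p0 // pz normr0; lra.
have {}pz : 0 < p (rcons s z) by rewrite lt_def pz p_ge0.
rewrite -(real_normK (num_real (dev i s z))).
set q := p _ in pz *; set d := `|_|; rewrite -subr_ge0.
rewrite (_ : _ - _ = (delta * q - d) ^+ 2 / (2 * delta * q)); last first.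
  by field; rewrite !gt_eqF.
by rewrite divr_ge0 ?sqr_ge0 // !mulr_ge0 // ltW.
Qed.

Lemma martingale_decoupling delta : 0 < delta -> (0 < m)%N ->
  #|I|%:R <= delta ^+ 2 * m%:R ->
  exists2 k, (k < m)%N & forall i z,
    `|\sum_(t : k.-tuple Y) (x i (rcons t z) - x i t * p (rcons t z) / p t)|
      <= delta * p [::].
Proof.
move=> d0 m0 Im; have [k km small] := good_level m0; exists k => // i z.
have p0 : 0 <= p [::] := p_ge0 _ i.
apply: le_trans (ler_norm_sum _ _ _) _.
(* AM-GM is summed over the strings, and both sums are enlarged from the given [i] and [z] to all
   indices. The weights then add up to [p [::]], and the good level bounds the squares by [delta ^+
   2 * p [::]]. *)
apply: (@le_trans _ _ ((delta * level k.+1 p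
    + delta^-1 * (total k.+1 - total k)) / 2)); last first.
  rewrite level_p // ler_pdivrMr // mulr_natr mulr2n lerD2l.
  have mR : 0 < m%:R :> R by rewrite ltr0n.
  rewrite -(ler_pM2l mR) mulrCA ler_pdivrMl //.
  apply: le_trans small _; apply: le_trans (ler_wpM2r p0 Im) _.
  by rewrite le_eqVlt; apply/orP; left; apply/eqP; ring.
rewrite -total_step // /level big_tuple_rcons.
have sub1 : \sum_(t : k.-tuple Y) p (rcons t z)
    <= \sum_(t : k.-tuple Y) \sum_z p (rcons t z).
  apply: ler_sum => t _; rewrite [leRHS](bigD1 z) //= lerDl sumr_ge0 // => y _.
  exact: p_ge0 i.
have dev_ge0 j t y : 0 <= dev j t y ^+ 2 / p (rcons t y).
  by rewrite divr_ge0 ?sqr_ge0 ?p_ge0.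
have sub2 : \sum_(t : k.-tuple Y) dev i t z ^+ 2 / p (rcons t z)
    <= \sum_i \sum_(t : k.-tuple Y) \sum_z dev i t z ^+ 2 / p (rcons t z).
  rewrite [leRHS](bigD1 i) //= ler_wpDr //.
    by rewrite sumr_ge0 // => j _; rewrite sumr_ge0 // => t _; rewrite sumr_ge0.
  by apply: ler_sum => t _; rewrite [leRHS](bigD1 z) //= lerDl sumr_ge0.
have di : 0 <= delta^-1 by rewrite invr_ge0 ltW.
apply: le_trans (_ : _ <= (delta * \sum_(t : k.-tuple Y) p (rcons t z) + delta^-1 *
    \sum_(t : k.-tuple Y) dev i t z ^+ 2 / p (rcons t z)) / 2) _.
  rewrite !mulr_sumr -big_split mulr_suml ler_sum // => t _.
  by apply: dev_amgm; rewrite ?size_tuple.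
by rewrite ler_pM2r ?invr_gt0 // lerD ?ler_wpM2l // ltW.
Qed.

End Martingale.

(** * Tensor powers and one-site marginals *)

Lemma linear_combination (K : pzRingType) (U V : lmodType K) (f : U -> V) :
  (forall c A B, f (c *: A + B) = c *: f A + f B) ->
  forall (I : finType) (c : I -> K) (A : I -> U),
    f (\sum_i c i *: A i) = \sum_i c i *: f (A i).
Proof.
move=> fL I c A; have f0 : f 0 = 0.
  by have := fL (-1) 0 0; rewrite !scaler0 addr0 scaleN1r addNr.
have fD B B' : f (B + B') = f B + f B' by rewrite -[B]scale1r fL !scale1r.
rewrite (big_morph f fD f0); apply: eq_bigr => i _.
by rewrite -[c i *: A i]addr0 fL f0 addr0.
Qed.

(** * Polarization and an informationally complete POVM *)

Section Polarization.
Variables (R : realType) (n : nat).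
Local Notation C := R[i].

Definition polar_vec (a b : 'I_n) (k : 'I_4) : 'cV[C]_n :=
  delta_mx a 0 + 'i ^+ k *: delta_mx b 0.

Definition polar_mx (abk : 'I_n * 'I_n * 'I_4) : 'M[C]_n :=
  let: (a, b, k) := abk in polar_vec a b k *m (polar_vec a b k)^t*.

Lemma polar_mxE a b k : polar_mx (a, b, k) = delta_mx a a
  + ('i ^+ k)^* *: delta_mx a b + 'i ^+ k *: delta_mx b a + delta_mx b b.
Proof.
rewrite /= /polar_vec trmxCD trmxCZ !trmxC_delta mulmxDl !mulmxDr.
rewrite -!scalemxAl -!scalemxAr !mul_delta_mx scalerA.
have -> : 'i ^+ k * ('i ^+ k)^* = 1 :> C.
  by rewrite -normCK normrX normCi !expr1n.
move: (delta_mx a a) (delta_mx a b) (delta_mx b a) (delta_mx b b) => *.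
by rewrite scale1r addrA.
Qed.

Lemma psd_polar_mx abk : psd (polar_mx abk).
Proof. by case: abk => -[a b] k; apply: psd_proj. Qed.

Let expi3 : 'i ^+ 3 = - 'i :> C.
Proof. by rewrite exprS sqrCi mulrN1. Qed.

Lemma polar_mx_sum a b :
  \sum_k polar_mx (a, b, k) = 4 *: (delta_mx a a + delta_mx b b).
Proof.
rewrite !big_ord_recl big_ord0 !polar_mxE /= !expr0 expr1 sqrCi expi3.
rewrite rmorph1 !rmorphN /= rmorph1 conjCi.
by apply/matrixP => x y; rewrite !mxE; ring.
Qed.

(** The weights ['i ^+ k] single out one matrix unit, because the powers of i and of -1 sum to zero
    over [k < 4]. *)
Lemma polarization a b :
  delta_mx a b = 4^-1 *: \sum_(k < 4) 'i ^+ k *: polar_mx (a, b, k).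
Proof.
rewrite !big_ord_recl big_ord0 !polar_mxE /= !expr0 expr1 sqrCi expi3.
rewrite rmorph1 !rmorphN /= rmorph1 conjCi.
have ii : 'i * 'i = -1 :> C by rewrite -expr2 sqrCi.
apply/matrixP => x y; rewrite !mxE.
set p := (_ && _)%:R; set q := (_ && _)%:R; set r := (_ && _)%:R.
set s := (_ && _)%:R.
(* In the middle expression ['i * 'i] is left unevaluated, so that [field] proves one equality
   without knowing its value and [ii] settles the other. *)
transitivity (4^-1 * (2 * (1 - 'i * 'i) * p + (2 * (1 + 'i * 'i)) * r)).
  by rewrite ii; field.
by field.
Qed.

Lemma psd_span (P : 'M[C]_n -> Prop) :
  (forall A B, P A -> P B -> P (A + B)) -> (forall c A, P A -> P (c *: A)) ->
  (forall A, psd A -> P A) -> forall A, P A.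
Proof.
move=> PD PZ Ppsd A.
have Psum I (r : seq I) F : (forall i, P (F i)) -> P (\sum_(i <- r) F i).
  by move=> PF; elim/big_rec: _ => [|i B _ PB]; [apply/Ppsd/psd0 | apply: PD].
rewrite (matrix_sum_delta A); do 2![apply: (Psum) => ?]; apply: (PZ).
rewrite polarization; apply: (PZ); apply: Psum => k.
by apply: PZ; apply/Ppsd/psd_polar_mx.
Qed.

(** By [polar_mx_sum] each pair [(a, b)] contributes 4 times two diagonal units. Summing over all
    pairs gives [8 * n] times the identity, whence the normalization. *)
Definition povm abk : 'M[C]_n := (8 * n)%:R^-1 *: polar_mx abk.

Lemma psd_povm abk : psd (povm abk).
Proof. by apply: psdZ (psd_polar_mx abk); rewrite invr_ge0. Qed.

Lemma sum_povm : \sum_abk povm abk = 1%:M.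
Proof.
have [n0|n0] := posnP n.
  by apply/matrixP => i; have := ltn_ord i; rewrite {2}n0.
rewrite -scaler_sumr (_ : \sum_abk _ = \sum_a \sum_b \sum_k polar_mx (a, b, k)).
  2: by rewrite !pair_bigA; apply: eq_bigr => -[[]].
under eq_bigr => a _ do under eq_bigr => b _ do rewrite polar_mx_sum.
under eq_bigr => a _ do rewrite -scaler_sumr big_split /= -mx1_sum_delta sumr_const.
rewrite -scaler_sumr big_split /= sumrMnl -mx1_sum_delta sumr_const card_ord.
rewrite -mulr2n -mulrnA -[1%:M *+ _]scaler_nat !scalerA -mulrA -natrM.
rewrite [X in _ * X%:R](_ : _ = 8 * n)%N; last by rewrite mulnCA [RHS]mulnC.
by rewrite mulVf ?scale1r // pnatr_eq0 muln_eq0 -lt0n.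
Qed.

(** Informational completeness: the POVM elements span all matrices. The coefficient is the
    normalization [8 * n] times the [4^-1] of polarization. *)
Lemma delta_povm a b :
  delta_mx a b = \sum_(k < 4) (2 * n%:R * 'i ^+ k) *: povm (a, b, k).
Proof.
have n0 : n%:R != 0 :> C by rewrite pnatr_eq0 -lt0n; apply: leq_trans (ltn_ord a).
rewrite polarization scaler_sumr; apply: eq_bigr => k _.
rewrite /povm !scalerA; congr (_ *: _); rewrite natrM; field; exact: n0.
Qed.

End Polarization.

Section TensorPower.
Variables (R : realType) (m d : nat).
Local Notation C := R[i].
Implicit Types Z : 'I_m -> 'M[C]_d.

Definition tens_mx Z : 'M[C]_(powdim m d) :=
  \matrix_(a, b) \prod_i
    Z i ((enum_val a : {ffun 'I_m -> 'I_d}) i) ((enum_val b : {ffun 'I_m -> 'I_d}) i).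

Lemma tens_mx_rank Z (f g : {ffun 'I_m -> 'I_d}) :
  tens_mx Z (enum_rank f) (enum_rank g) = \prod_i Z i (f i) (g i).
Proof. by rewrite mxE !enum_rankK. Qed.

Lemma powdim_matrixP (A B : 'M[C]_(powdim m d)) :
  (forall f g : {ffun 'I_m -> 'I_d},
     A (enum_rank f) (enum_rank g) = B (enum_rank f) (enum_rank g)) -> A = B.
Proof.
by move=> AB; apply/matrixP => a b; rewrite -(enum_valK a) -(enum_valK b).
Qed.

Lemma sum_powdim (F : 'I_(powdim m d) -> C) :
  \sum_a F a = \sum_(f : {ffun 'I_m -> 'I_d}) F (enum_rank f).
Proof. by rewrite (reindex _ (onW_bij _ (@enum_rank_bij _))). Qed.

Lemma tens_mx1 : tens_mx (fun=> 1%:M) = 1%:M.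
Proof.
apply: powdim_matrixP => f g; rewrite tens_mx_rank mxE (inj_eq enum_rank_inj).
have [->|fg] := eqVneq f g; first by rewrite big1 // => i _; rewrite mxE eqxx.
have [i fgi] : exists i, f i != g i.
  apply/existsP; apply: contraR fg; rewrite negb_exists => /forallP h.
  by apply/eqP/ffunP => i; apply/eqP; have := h i; rewrite negbK.
by rewrite (bigD1 i) //= mxE (negPf fgi) mul0r.
Qed.

Lemma tens_mxM Z Z' : tens_mx Z *m tens_mx Z' = tens_mx (fun i => Z i *m Z' i).
Proof.
apply: powdim_matrixP => f g; rewrite mxE sum_powdim tens_mx_rank.
under [RHS]eq_bigr do rewrite mxE.
rewrite bigA_distr_bigA; apply: eq_bigr => h _.
by rewrite !tens_mx_rank big_split.
Qed.

Lemma tens_mx_trC Z : (tens_mx Z)^t* = tens_mx (fun i => (Z i)^t*).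
Proof.
apply: powdim_matrixP => f g; rewrite !mxE !enum_rankK rmorph_prod.
by apply: eq_bigr => i _; rewrite !mxE.
Qed.

Lemma psd_tens_mx Z : (forall i, psd (Z i)) -> psd (tens_mx Z).
Proof.
move=> psdZ.
have [D ZD] := choice (fun i => psd_factor (psdZ i)).
rewrite (_ : Z = fun i => (D i)^t* *m D i); last exact/funext.
by rewrite -tens_mxM -tens_mx_trC; apply: psd_gram.
Qed.

Lemma mxtrace_mul_tens (X : 'M[C]_(powdim m d)) Z :
  \tr (X *m tens_mx Z) = \sum_(f : {ffun 'I_m -> 'I_d})
    \sum_(g : {ffun 'I_m -> 'I_d})
      X (enum_rank f) (enum_rank g) * \prod_i Z i (g i) (f i).
Proof.
rewrite /mxtrace sum_powdim; apply: eq_bigr => f _.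
by rewrite mxE sum_powdim; apply: eq_bigr => g _; rewrite tens_mx_rank.
Qed.

Definition set_slot Z (i : 'I_m) (A : 'M[C]_d) : 'I_m -> 'M[C]_d :=
  fun j => if j == i then A else Z j.

Lemma tens_set_slot_linear Z i c A B :
  tens_mx (set_slot Z i (c *: A + B))
  = c *: tens_mx (set_slot Z i A) + tens_mx (set_slot Z i B).
Proof.
have E M (f g : {ffun 'I_m -> 'I_d}) :
    tens_mx (set_slot Z i M) (enum_rank f) (enum_rank g) =
    M (f i) (g i) * \prod_(j | j != i) Z j (f j) (g j).
  rewrite tens_mx_rank (bigD1 i) //= /set_slot eqxx; congr (_ * _).
  by apply: eq_bigr => j ji; rewrite (negPf ji).
apply: powdim_matrixP => f g; rewrite E [RHS]mxE [X in _ = X + _]mxE !E !mxE.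
by rewrite mulrDl mulrA.
Qed.

Definition slot := set_slot (fun=> 1%:M).

(** The partial trace by duality: its [(x, y)] entry is the trace against the unit [delta_mx y x] at
    site [i] and identities elsewhere. Operators are inserted into slots this way from here on. *)
Lemma marginalE i (X : 'M[C]_(powdim m d)) x y :
  marginal i X x y = \tr (X *m tens_mx (slot i (delta_mx y x))).
Proof.
rewrite mxE mxtrace_mul_tens big_mkcond; apply: eq_bigr => f _.
have E g : \prod_j slot i (delta_mx y x) j (g j) (f j)
    = ((f i == x) && ((g i == y) && [forall j, (j != i) ==> (f j == g j)]))%:R :> C.
  rewrite (bigD1 i) //= /slot /set_slot eqxx mxE; have [fx|] := eqVneq (f i) x; last first.
    by rewrite andbF mul0r.
  rewrite andbT; have [gy|] := eqVneq (g i) y; last by rewrite mul0r.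
  rewrite mul1r /=; have [/forallP h|] := boolP [forall j, (j != i) ==> (f j == g j)].
    rewrite big1 // => j ji; rewrite (negPf ji) mxE.
    by have := h j; rewrite ji /= => /eqP->; rewrite eqxx.
  rewrite negb_forall => /existsP[j]; rewrite negb_imply => /andP[ji fgj].
  by rewrite (bigD1 j) //= (negPf ji) mxE eq_sym (negPf fgj) mul0r.
under [RHS]eq_bigr do rewrite E.
case: (f i == x) => /=; last by rewrite big1 // => g _; rewrite mulr0.
by rewrite [LHS]big_mkcond; apply: eq_bigr => g _; case: ifP => _; rewrite ?mulr1 ?mulr0.
Qed.

Lemma perm_unitary_trC (s : 'S_m) :
  (perm_unitary R d s)^t* = perm_unitary R d s^-1.
Proof.
apply: powdim_matrixP => f g; rewrite !mxE !enum_rankK rmorph_nat.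
congr (nat_of_bool _)%:R; apply/idP/idP => /eqP->; apply/eqP/ffunP => i; rewrite !ffunE.
  by rewrite permKV.
by rewrite permK.
Qed.

Lemma perm_unitary_conj (s : 'S_m) (X : 'M[C]_(powdim m d)) f g :
  (perm_unitary R d s *m X *m (perm_unitary R d s)^t*) (enum_rank f) (enum_rank g)
  = X (enum_rank [ffun i => f (s i)]) (enum_rank [ffun i => g (s i)]).
Proof.
rewrite mxE sum_powdim (bigD1 [ffun i => g (s i)]) //= big1 ?addr0; last first.
  by move=> h hg; rewrite !mxE !enum_rankK (negPf hg) rmorph0 mulr0.
rewrite !mxE !enum_rankK eqxx rmorph1 mulr1.
rewrite sum_powdim (bigD1 [ffun i => f (s i)]) //= big1 ?addr0; last first.
  by move=> h hf; rewrite !mxE !enum_rankK (negPf hf) mul0r.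
by rewrite !mxE !enum_rankK eqxx mul1r.
Qed.

(** By cyclicity the conjugation passes from [X] to the product operator, whose factors it
    permutes. *)
Lemma mxtrace_tens_perm (s : 'S_m) (X : 'M[C]_(powdim m d)) Z :
  perm_unitary R d s *m X *m (perm_unitary R d s)^t* = X ->
  \tr (X *m tens_mx (Z \o s)) = \tr (X *m tens_mx Z).
Proof.
move=> XE; rewrite -[in RHS]XE -!mulmxA [RHS]mxtrace_mulC -!mulmxA.
congr (\tr (_ *m _)); rewrite mulmxA perm_unitary_trC.
have -> : perm_unitary R d s = (perm_unitary R d s^-1)^t*.
  by rewrite perm_unitary_trC invgK.
apply: powdim_matrixP => f g.
rewrite perm_unitary_conj !tens_mx_rank (reindex_inj (@perm_inj _ s^-1)) /=.
by apply: eq_bigr => i _; rewrite !ffunE permKV.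
Qed.

End TensorPower.

(** * Channels and their Choi matrices *)

Section Channels.
Variables (R : realType) (n p : nat).
Local Notation C := R[i].

Lemma delta_blockE (F : 'I_n -> 'I_n -> 'M[C]_p) a x b y :
  (\sum_i \sum_j delta_mx i j *t F i j) (mxtens_index (a, x)) (mxtens_index (b, y))
  = F a b x y.
Proof.
have E i j : (delta_mx i j *t F i j) (mxtens_index (a, x)) (mxtens_index (b, y))
    = if (i == a) && (j == b) then F a b x y else 0.
  rewrite tensmxE mxE ![_ == a]eq_sym ![_ == b]eq_sym.
  by case: eqP => [<-|]; case: eqP => [<-|]; rewrite /= (mul1r, mul0r).
rewrite summxE (bigD1 a) //= [X in _ + X]big1 ?addr0 => [|i ia].
  rewrite summxE (bigD1 b) //= [X in _ + X]big1 ?addr0 => [|j jb].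
    by rewrite E !eqxx.
  by rewrite E (negPf jb) andbF.
by rewrite summxE big1 // => j _; rewrite E (negPf ia).
Qed.

Lemma choiE (F : 'M[C]_n -> 'M[C]_p) a x b y :
  choi F (mxtens_index (a, x)) (mxtens_index (b, y)) = F (delta_mx a b) x y.
Proof. exact: delta_blockE. Qed.

Lemma choi_idtensE q (F : 'M[C]_n -> 'M[C]_p) (H : 'M[C]_p -> 'M[C]_q) :
  idtens H (choi F) = choi (H \o F).
Proof.
apply: eq_bigr => i _; apply: eq_bigr => j _; congr (_ *t H _).
by apply/matrixP => a b; rewrite mxE choiE.
Qed.

Lemma linear_mx_sum (F : {linear 'M[C]_n -> 'M[C]_p}) X :
  F X = \sum_i \sum_j X i j *: F (delta_mx i j).
Proof.
rewrite {1}(matrix_sum_delta X) raddf_sum; apply: eq_bigr => i _.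
by rewrite raddf_sum; apply: eq_bigr => j _; rewrite /= linearZ.
Qed.

(** The instance [k = 1] of complete positivity. The tensor factor [I1] and the reindexing [sum1]
    only translate between the sizes [1 * n] and [n]. *)
Lemma completely_positive_psd (F : {linear 'M[C]_n -> 'M[C]_p}) X :
  completely_positive F -> psd X -> psd (F X).
Proof.
move=> cpF /psd_factor[D XE].
pose I1 : 'M[C]_1 := 1%:M.
have psdX : psd (tensmx I1 X).
  have -> : tensmx I1 X = (tensmx I1 D)^t* *m tensmx I1 D.
    by rewrite trmx_tens map_mxT tensmx_mul -XE trmx1 map_mx1 mul1mx.
  exact: psd_gram.
have sum1 (f : 'I_(1 * p) -> C) : \sum_k f k = \sum_x f (mxtens_index (ord0, x)).
  rewrite (reindex (fun x : 'I_p => mxtens_index (ord0 : 'I_1, x))) //.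
  exists (fun k => (mxtens_unindex k).2) => [x|k] _; first by rewrite mxtens_indexK.
  by case: (mxtens_indexP k) => i x; rewrite mxtens_indexK (ord1 i) (ord1 ord0).
move=> v; have := cpF 1%N _ psdX (\col_k v (mxtens_unindex k).2 0).
have blk : (\matrix_(a, b) (tensmx I1 X) (mxtens_index (ord0, a))
    (mxtens_index (ord0, b))) = X.
  by apply/matrixP => a b; rewrite mxE tensmxE mxE mul1r.
rewrite /idtens !big_ord1 blk; congr (_ <= _).
rewrite !mxE sum1; apply: eq_bigr => x _; rewrite !mxE mxtens_indexK; congr (_ * _).
rewrite sum1; apply: eq_bigr => y _.
by rewrite tensmxE !mxE mxtens_indexK eqxx mul1r.
Qed.

Lemma channel_density (F : {linear 'M[C]_n -> 'M[C]_p}) X :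
  is_channel F -> density X -> density (F X).
Proof.
move=> [cpF tpF] [psdX trX].
by split; [apply: completely_positive_psd | rewrite tpF].
Qed.

Lemma density_entry (X : 'M[C]_n) i j : density X -> `|X i j| <= 2.
Proof.
move=> [psdX trX]; have [] := psd_entry i j psdX; rewrite trX => h1 h2.
by apply: le_trans (norm_reim h1 h2) _; rewrite -(rmorph_nat (real_complex R)) lecR.
Qed.

End Channels.

Section Protocols.
Variables (R : realType) (dA dB m : nat).
Local Notation C := R[i].
Variable T : {linear 'M[C]_dA -> 'M[C]_(powdim m dB)}.

(** The common consequence of exchange invariance and of bosonic symmetry through which the symmetry
    of the protocol enters. *)
Definition perm_invariant : Prop := forall s X,
  perm_unitary R dB s *m T X *m (perm_unitary R dB s)^t* = T X.

Lemma exchange_perm_invariant : exchange_invariant T -> perm_invariant.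
Proof.
move=> exT s X; have := exT s; rewrite /= /choi.
set U := perm_unitary R dB s => inv.
have deltaU a b : U *m T (delta_mx a b) *m U^t* = T (delta_mx a b).
  apply/matrixP => x y; rewrite -[RHS]choiE /choi -inv trmx_tens map_mxT trmx1 map_mx1.
  rewrite mulmx_sumr mulmx_suml -[LHS](delta_blockE (fun a b => U *m T (delta_mx a b) *m U^t*)).
  congr (fun_of_matrix _ _ _); apply: eq_bigr => i _.
  rewrite mulmx_sumr mulmx_suml; apply: eq_bigr => j _.
  by rewrite !tensmx_mul mul1mx mulmx1.
rewrite (linear_mx_sum T) mulmx_sumr mulmx_suml; apply: eq_bigr => i _.
rewrite mulmx_sumr mulmx_suml; apply: eq_bigr => j _.
by rewrite -scalemxAr -scalemxAl deltaU.
Qed.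

(** The symmetric support gives U T(A) = T(A) for densities A. Adjoints give T(A) U* = T(A), since
    T(A) is Hermitian, and [psd_span] extends the invariance to all arguments. *)
Lemma bosonic_perm_invariant :
  completely_positive T -> bosonic T -> perm_invariant.
Proof.
move=> cpT bosT s X; set U := perm_unitary R dB s.
have UT A : density A -> U *m T A = T A.
  move=> dA_; apply/matrixP => i j; have := bosT A dA_ (delta_mx j 0) s.
  rewrite mulmxA => /matrixP/(_ i 0).
  by rewrite -!colE !mxE.
move: X; apply: psd_span => [A B hA hB|c A hA|A psdA].
- by rewrite linearD /= mulmxDr mulmxDl hA hB.
- by rewrite linearZ /= -scalemxAr -scalemxAl hA.
have [t0|t0] := eqVneq (\tr A) 0.
  by rewrite (psd_tr0 psdA t0) linear0 mulmx0 mul0mx.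
have /UT : density ((\tr A)^-1 *: A).
  split; first by apply: psdZ; rewrite // invr_ge0 psd_mxtrace.
  by rewrite mxtraceZ mulVf.
rewrite linearZ /= -scalemxAr => /(congr1 (fun M => \tr A *: M)).
rewrite !scalerA divff // !scale1r => UTA; rewrite UTA.
have herm := psd_hermitian (completely_positive_psd cpT psdA).
by rewrite -[T A in LHS]herm -trmxC_mul UTA herm.
Qed.

Hypothesis chT : is_channel T.
Hypothesis invT : perm_invariant.

(** The partial trace over the outputs of the Choi matrix multiplied by the identity on A tensored
    with [tens_mx Z]. *)
Definition slot_mx (Z : 'I_m -> 'M[C]_dB) : 'M[C]_dA :=
  \matrix_(a, b) \tr (T (delta_mx a b) *m tens_mx Z).

Lemma slot_mx_sum X Z :
  \tr (T X *m tens_mx Z) = \sum_a \sum_b X a b * slot_mx Z a b.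
Proof.
rewrite linear_mx_sum mulmx_suml raddf_sum; apply: eq_bigr => a _.
rewrite mulmx_suml raddf_sum; apply: eq_bigr => b _.
by rewrite -scalemxAl /= mxtraceZ mxE.
Qed.

Lemma psd_slot_mx Z : (forall i, psd (Z i)) -> psd (slot_mx Z).
Proof.
(* [w] is the entrywise conjugate of [v], because [slot_mx] is the transpose of the operator that
   the dual of [T] assigns to [tens_mx Z]. *)
move=> psdZ v; pose w := (v^t*)^T.
have := psd_mxtrace_mul (completely_positive_psd chT.1 (psd_proj w)) (psd_tens_mx psdZ).
rewrite slot_mx_sum; congr (_ <= _).
rewrite mxE exchange_big; apply: eq_bigr => b _.
rewrite mxE mulr_suml; apply: eq_bigr => a _.
by rewrite !mxE big_ord1 !mxE conjCK mulrAC.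
Qed.

Lemma slot_mx_perm (s : 'S_m) Z : slot_mx (Z \o s) = slot_mx Z.
Proof. by apply/matrixP => a b; rewrite mxE [RHS]mxE mxtrace_tens_perm. Qed.

Lemma marginal_perm i j X : marginal i (T X) = marginal j (T X).
Proof.
apply/matrixP => x y; rewrite !marginalE -(mxtrace_tens_perm (s := tperm i j)) //.
congr (\tr (_ *m tens_mx _)); apply/funext => k /=; rewrite /slot /set_slot.
by case: tpermP => [->|->|/eqP/negPf-> /eqP/negPf->]; rewrite ?eqxx // eq_sym.
Qed.

End Protocols.

Section Marginals.
Variables (R : realType) (dB m : nat) (i : 'I_m).
Local Notation C := R[i].
Implicit Types X : 'M[C]_(powdim m dB).

Lemma marginalD X X' : marginal i (X + X') = marginal i X + marginal i X'.
Proof.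
by apply/matrixP => x y; rewrite [RHS]mxE !marginalE mulmxDl mxtraceD.
Qed.

Lemma marginalZ c X : marginal i (c *: X) = c *: marginal i X.
Proof.
by apply/matrixP => x y; rewrite [RHS]mxE !marginalE -scalemxAl mxtraceZ.
Qed.

Lemma marginal0 : marginal i (0 : 'M[C]_(powdim m dB)) = 0.
Proof. by rewrite -(scale0r 0) marginalZ scale0r. Qed.

Lemma marginal_mxtrace_mul X Z :
  \tr (marginal i X *m Z) = \tr (X *m tens_mx (slot i Z)).
Proof.
have slotL := @tens_set_slot_linear R m dB (fun=> 1%:M) i.
have -> : Z = \sum_(yx : 'I_dB * 'I_dB) Z yx.1 yx.2 *: delta_mx yx.1 yx.2.
  by rewrite {1}(matrix_sum_delta Z) pair_bigA.
rewrite (linear_combination slotL) !mulmx_sumr !raddf_sum; apply: eq_bigr => -[y x] _.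
rewrite -!scalemxAr /= !mxtraceZ -marginalE; congr (_ * _).
rewrite /mxtrace (bigD1 x) //= big1 ?addr0 => [|j jx].
  rewrite mxE (bigD1 y) //= big1 ?addr0 => [|k ky].
    by rewrite [delta_mx _ _ _ _]mxE !eqxx mulr1.
  by rewrite [delta_mx _ _ _ _]mxE (negPf ky) mulr0.
by rewrite mxE big1 // => k _; rewrite [delta_mx _ _ _ _]mxE (negPf jx) andbF mulr0.
Qed.

Lemma mxtrace_marginal X : \tr (marginal i X) = \tr X.
Proof.
rewrite -[LHS](congr1 _ (mulmx1 _)) marginal_mxtrace_mul.
rewrite (_ : slot i 1%:M = fun=> 1%:M) ?tens_mx1 ?mulmx1 //.
by apply/funext => j; rewrite /slot /set_slot; case: ifP.
Qed.

Lemma psd_marginal X : psd X -> psd (marginal i X).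
Proof.
move=> psdX v.
have := psd_mxtrace_mul psdX (psd_tens_mx (Z := slot i (v *m v^t*)) _).
rewrite -marginal_mxtrace_mul mulmxA mxtrace_mulC mulmxA trace_mx11; apply=> j.
by rewrite /slot /set_slot; case: ifP => _; [apply: psd_proj | apply: psd1].
Qed.

Lemma density_marginal X : density X -> density (marginal i X).
Proof. by move=> [psdX trX]; split; [apply: psd_marginal|rewrite mxtrace_marginal]. Qed.

End Marginals.

(** * A finite de Finetti bound for one marginal *)

Section DeFinetti.
Variables (R : realType) (dA dB m : nat).
Local Notation C := R[i].
Local Open Scope complex_scope.
Variable T : {linear 'M[C]_dA -> 'M[C]_(powdim m.+1 dB)}.
Hypothesis chT : is_channel T.
Hypothesis invT : perm_invariant T.

Let Y := ('I_dB * 'I_dB * 'I_4)%type.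
Let I := (bool * 'I_dA * 'I_dA)%type.

Let slots (s : seq 'M[C]_dB) (i : 'I_m.+1) : 'M[C]_dB := nth 1%:M s i.

(* [G s] is the operator on A left by contracting the outputs with the
   operators [s], the outputs beyond [size s] being traced out. *)
Let G (s : seq 'M[C]_dB) : 'M[C]_dA := slot_mx T (slots s).

Let G_rcons_linear s c Z W : (size s <= m)%N ->
  G (rcons s (c *: Z + W)) = c *: G (rcons s Z) + G (rcons s W).
Proof.
move=> sm; have E V : slots (rcons s V) = set_slot (slots s) (inord (size s)) V.
  apply/funext => j; rewrite /slots /set_slot nth_rcons -(inj_eq val_inj) /= inordK //.
  case: ltngtP => // js; rewrite nth_default //; exact: ltnW.
apply/matrixP => a b; rewrite /G !E !mxE tens_set_slot_linear.
by rewrite mulmxDr -scalemxAr mxtraceD mxtraceZ.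
Qed.

Let G_rcons1 s : G (rcons s 1%:M) = G s.
Proof.
congr slot_mx; apply/funext => j; rewrite /slots nth_rcons.
by case: ltngtP => // js; rewrite nth_default // ?js // ltnW.
Qed.

(** An operator on output 0 may be moved to the first free output, of index [(size s).+1], by
    exchanging the two. The bound on [size s] ensures that this output exists. *)
Let G_cons s Z : (size s < m)%N -> G (Z :: s) = G (rcons (1%:M :: s) Z).
Proof.
move=> sm; rewrite /G -[LHS](slot_mx_perm invT (tperm ord0 (inord (size s).+1))).
congr slot_mx; apply/funext => j; rewrite /slots /=.
have k0 : (inord (size s).+1 : 'I_m.+1) = (size s).+1 :> nat by rewrite inordK.
case: tpermP => [->|->|/eqP j0 /eqP jk].
- by rewrite k0 /= nth_default // nth_rcons; case: ltngtP.
- by rewrite k0 /= nth_rcons ltnn eqxx.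
case: j j0 jk => -[|j] // jm _ jk /=; rewrite nth_rcons.
case: ltngtP => // js; first by rewrite nth_default // ltnW.
by case/eqP: jk; apply: val_inj; rewrite /= k0 js.
Qed.

Let G_rcons_sum s (J : finType) (c : J -> C) (Z : J -> 'M[C]_dB) : (size s <= m)%N ->
  G (rcons s (\sum_j c j *: Z j)) = \sum_j c j *: G (rcons s (Z j)).
Proof.
move=> sm; apply: (linear_combination (f := fun W => G (rcons s W))) => a U V.
exact: G_rcons_linear.
Qed.

Let G_cons_sum s (J : finType) (c : J -> C) (Z : J -> 'M[C]_dB) : (size s < m)%N ->
  G ((\sum_j c j *: Z j) :: s) = \sum_j c j *: G (Z j :: s).
Proof.
move=> sm; apply: etrans (G_cons _ sm) _.
apply: etrans (@G_rcons_sum (_ :: s) J c Z sm) _.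
by apply: eq_bigr => j _; rewrite -(G_cons (Z j) sm).
Qed.

Let psd_G s : (forall Z, Z \in s -> psd Z) -> psd (G s).
Proof.
move=> psds; apply: psd_slot_mx => // i; rewrite /slots.
have [is_|is_] := ltnP i (size s); first exact/psds/mem_nth.
by rewrite nth_default //; apply: psd1.
Qed.

Let pv (t : seq Y) : seq 'M[C]_dB := map (@povm R dB) t.

Let psd_pv t Z : psd Z -> psd (G (Z :: pv t)).
Proof.
move=> psdZ; apply: psd_G => W; rewrite inE => /orP[/eqP->//|/mapP[y _ ->]].
exact: psd_povm.
Qed.

(** Output 0 is traced out and the outcomes [t] occupy the next outputs, so [m] of the [m.+1]
    outputs are available for measurement. *)
Let A t := G (1%:M :: pv t).

Let A_rcons t y : (size t < m)%N -> A (rcons t y) = G (povm R y :: pv t).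
Proof. by move=> tm; rewrite /A /pv map_rcons G_cons // size_map. Qed.

Let G_split s t : (size s + size t <= m)%N ->
  \sum_y G (s ++ pv (rcons t y)) = G (s ++ pv t).
Proof.
move=> stm; rewrite -[RHS]G_rcons1 -(sum_povm R dB).
under [X in rcons _ X]eq_bigr do rewrite -[povm _ _]scale1r.
rewrite G_rcons_sum ?size_cat ?size_map //; apply: eq_bigr => y _.
by rewrite scale1r /pv map_rcons rcons_cat.
Qed.

Let p t := complex.Re (\tr (A t)).
Let x (i : I) t := reim i.1.1 (A t i.1.2 i.2).

Let psd_A t : psd (A t). Proof. exact/psd_pv/psd1. Qed.

Let pE t : (p t)%:C = \tr (A t).
Proof. by rewrite RRe_real // ger0_real // psd_mxtrace. Qed.

Let p_split t : (size t < m)%N -> \sum_y p (rcons t y) = p t.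
Proof.
move=> tm; rewrite /p -[A t](@G_split [:: 1%:M] t tm) [\tr (\sum_y _)]raddf_sum.
by rewrite -(reim_sum true).
Qed.

Let x_split i t : (size t < m)%N -> \sum_y x i (rcons t y) = x i t.
Proof.
by move=> tm; rewrite /x -[A t](@G_split [:: 1%:M] t tm) summxE reim_sum.
Qed.

Let x_le i t : `|x i t| <= p t.
Proof.
by case: i => -[h a] b; have [h1 h2] := psd_entry a b (psd_A t); case: h.
Qed.

(** The Choi matrix of a channel has trace [dA], not 1; this total weight enters the error bound. *)
Let p_nil : p [::] = dA%:R.
Proof.
apply: (@complexI R); rewrite pE /A /G rmorph_nat /mxtrace.
rewrite (_ : slots _ = fun=> 1%:M); last first.
  by apply/funext => j; rewrite /slots; case: j => -[|[]].
under eq_bigr do rewrite mxE tens_mx1 mulmx1 chT.2.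
by rewrite -[LHS]raddf_sum -mx1_sum_delta /= mxtrace1.
Qed.

(* The unnormalized state of the next output, conditioned on the outcomes t. *)
Let B t : 'M[C]_dB := \matrix_(x, x') \tr (G (delta_mx x' x :: pv t)).

Let psd_B t : (size t < m)%N -> psd (B t).
Proof.
move=> tm v; have := psd_mxtrace (psd_pv t (psd_proj v)).
rewrite (_ : v *m v^t* = \sum_(yx : 'I_dB * 'I_dB)
    (v yx.1 0 * (v yx.2 0)^*) *: delta_mx yx.1 yx.2)%R; last first.
  rewrite [LHS]matrix_sum_delta pair_bigA; apply: eq_bigr => -[a b] _.
  by rewrite !mxE big_ord1 !mxE.
rewrite G_cons_sum ?size_map // raddf_sum; congr (_ <= _).
rewrite mxE -(pair_bigA _ (fun y x => \tr ((v y 0 * (v x 0)^*)%R *: G (delta_mx y x :: pv t)))).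
apply: eq_bigr => a _; rewrite mxE mulr_suml; apply: eq_bigr => b _.
by rewrite !mxE mxtraceZ; ring.
Qed.

(** Measuring [k] further outputs and forgetting the outcomes amounts to tracing these outputs out,
    as the POVM sums to the identity. *)
Let marginal_split k a b y z : (k <= m)%N ->
  marginal ord0 (T (delta_mx a b)) y z
  = (\sum_(t : k.-tuple Y) G (delta_mx z y :: pv t)) a b.
Proof.
elim: k => [|k IHk] km.
  rewrite (big_pred1 [tuple]) => [|t]; last by rewrite (tuple0 t) /= eq_refl.
  rewrite marginalE mxE; congr (\tr (_ *m tens_mx _)).
  by apply/funext => -[[|j] jm]; rewrite /slot /set_slot /slots //= nth_nil.
rewrite IHk 1?ltnW // (big_tuple_rcons _ (fun t => G (delta_mx z y :: pv t))); congr (fun_of_matrix _ a b).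
apply: eq_bigr => t _; rewrite -[LHS](@G_split [:: _] t) //=.
by rewrite size_tuple.
Qed.

(** A matrix unit on output 0 is a combination of POVM elements by [delta_povm], and [A_rcons] reads
    each of them as one more measurement. The distance to a product state given [t] is thus a
    combination of the martingale increments, small at a good level [k]. *)
Lemma marginal_near_separable delta : 0 < delta -> (0 < m)%N ->
  #|{: bool * 'I_dA * 'I_dA}|%:R <= delta ^+ 2 * m%:R ->
  exists S, separable S /\ forall i j,
    `|choi (marginal ord0 \o T) i j - S i j| <= (16 * dA%:R * dB%:R * delta)%:C.
Proof.
move=> d0 m0 dm.
have [k km small] := martingale_decoupling p_split x_split x_le d0 m0 dm.
(* Given [t], the state of A and output 0 is replaced by the product of its marginals. Both factors
   carry the weight of [t], hence one division by [p t]. *)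
exists (\sum_(t : k.-tuple Y) ((p t)^-1%:C *: A t) *t B t); split.
  apply: separable_sum => t; last by apply: psd_B; rewrite size_tuple.
  by apply: psdZ (psd_A t); rewrite ler0c invr_ge0 -ler0c pE psd_mxtrace.
move=> i j; case: (mxtens_indexP i) => a y; case: (mxtens_indexP j) => b z.
rewrite choiE /= (marginal_split _ _ _ _ (ltnW km)) !summxE -sumrB.
pose c (l : 'I_4) : C := 2 * dB%:R * Num.imaginary ^+ l.
pose dev l (t : k.-tuple Y) := A (rcons t (z, y, l)) a b
  - A t a b * (p (rcons t (z, y, l)))%:C / (p t)%:C.
have -> : (\sum_(t : k.-tuple Y) (G (delta_mx z y :: pv t) a b
    - (((p t)^-1%:C *: A t) *t B t) (mxtens_index (a, y)) (mxtens_index (b, z))))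
    = \sum_(l < 4) c l * \sum_(t : k.-tuple Y) dev l t.
  under [RHS]eq_bigr do rewrite mulr_sumr.
  rewrite exchange_big; apply: eq_bigr => t _.
  have tm : (size t < m)%N by rewrite size_tuple.
  have GE : G (delta_mx z y :: pv t) = \sum_(l < 4) c l *: A (rcons t (z, y, l)).
    have ptm : (size (pv t) < m)%N by rewrite size_map.
    rewrite delta_povm; apply: etrans (G_cons_sum _ _ ptm) _.
    by apply: eq_bigr => l _; rewrite (A_rcons _ tm).
  have BE : B t y z = \sum_(l < 4) c l * (p (rcons t (z, y, l)))%:C.
    rewrite mxE GE raddf_sum; apply: eq_bigr => l _ /=.
    by rewrite mxtraceZ pE.
  rewrite tensmxE BE GE summxE mulr_sumr -sumrB; apply: eq_bigr => l _.
  by rewrite [X in X - _]mxE [X in _ - X * _]mxE /dev fmorphV; ring.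
apply: le_trans (ler_norm_sum _ _ _) _.
(* Each coefficient has modulus [2 * dB], and the real and imaginary parts contribute [delta * dA]
   each. The four values of [l] then give the constant 16. *)
have bound l : `|c l * \sum_(t : k.-tuple Y) dev l t| <= (2 * dB%:R * (2 * (delta * dA%:R)))%:C.
  rewrite normrM (rmorphM (real_complex R)) ler_pM //.
    by rewrite /c !normrM normrX normCi expr1n mulr1 !normr_nat rmorphM !rmorph_nat.
  rewrite mulr_natl mulr2n -p_nil; have devE h : reim h (\sum_(t : k.-tuple Y) dev l t) =
      \sum_(t : k.-tuple Y) (x (h, a, b) (rcons t (z, y, l))
        - x (h, a, b) t * p (rcons t (z, y, l)) / p t).
    rewrite reim_sum; apply: eq_bigr => t _; rewrite /dev reimB; congr (_ - _).
    by rewrite -fmorphV -mulrA -rmorphM mulrC reimZ mulrC mulrA.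
  by apply: norm_reim; rewrite devE; apply: small.
apply: le_trans (ler_sum _ (fun l _ => bound l)) _.
rewrite sumr_const card_ord -rmorphMn lecR le_eqVlt; apply/orP; left; apply/eqP.
by ring.
Qed.

End DeFinetti.

(** * Uniform perturbation of suprema and integrals *)

Section Perturbation.
Local Open Scope ereal_scope.

(** Both inequalities add a finite error, so that they remain meaningful when [l] or [F m] is
    infinite. *)
Lemma ereal_perturb_cvg (R : realType) (F : nat -> \bar R) (l : \bar R)
    (e : nat -> R) :
  e m @[m --> \oo] --> 0%R ->
  (forall m, F m <= l + (e m)%:E) -> (forall m, l <= F m + (e m)%:E) ->
  F m @[m --> \oo] --> l.
Proof.
move=> e0 Fl lF.
have E0 : (e m)%:E @[m --> \oo] --> 0%:E by apply: cvg_EFin => //; exact: nearW.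
have EN0 : (- (e m)%:E) @[m --> \oo] --> - 0%:E by apply: cvgeN.
apply: (@squeeze_cvge _ _ _ _ (fun m => l - (e m)%:E) _ (fun m => l + (e m)%:E)).
- by apply: nearW => m; rewrite leeBlDr // lF Fl.
- rewrite -[X in _ --> X]adde0 -[X in _ + X]oppe0; apply: cvgeD => //.
    by rewrite oppe0 fin_num_adde_defl.
  exact: cvg_cst.
- rewrite -[X in _ --> X]adde0; apply: cvgeD => //.
    by rewrite fin_num_adde_defl.
  exact: cvg_cst.
Qed.

Lemma ereal_sup_perturb (R : realType) T (X : set T) (f g : T -> R) (e : R) :
  (forall x, X x -> (f x <= g x + e)%R) ->
  ereal_sup [set (f x)%:E | x in X] <= ereal_sup [set (g x)%:E | x in X] + e%:E.
Proof.
move=> fg; apply: ge_ereal_sup => _ [x Xx <-].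
apply: (@le_trans _ _ ((g x)%:E + e%:E)); first by rewrite -EFinD lee_fin fg.
by rewrite leeD2r // ereal_sup_ubound //; exists x.
Qed.

Section IntegralPerturbation.
Context d (T : measurableType d) (R : realType) (P : probability T R).

Import HBNNSimple.

(* The integral of a nonnegative function, measurable or not, is the supremum
   of the integrals of the simple functions below it. *)
Lemma lower_integral_le (f g : T -> \bar R) :
  (forall x, 0 <= f x) -> (forall x, f x <= g x) ->
  \int[P]_x f x <= \int[P]_x g x.
Proof.
move=> f0 fg; have g0 x : 0 <= g x by apply: le_trans (fg x).
rewrite !ge0_integralTE //; apply: le_ereal_sup => _ [h hf <-].
by exists h => // x; apply: le_trans (hf x) (fg x).
Qed.

(** For a simple function [s] below [f], the truncation max(s - e, 0) is measurable and lies below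
    [g]. Additivity is applied to it and a constant only, so [f] and [g] may be nonmeasurable. *)
Lemma ge0_integral_perturb (f g : T -> \bar R) (e : R) :
  (0 <= e)%R -> (forall x, 0 <= f x) -> (forall x, 0 <= g x) ->
  (forall x, f x <= g x + e%:E) -> \int[P]_x f x <= \int[P]_x g x + e%:E.
Proof.
move=> e0 f0 g0 fg; rewrite [leLHS]ge0_integralTE //; apply: ge_ereal_sup => _ [s sf <-].
rewrite -integralT_nnsfun.
pose h x : R := Num.max (s x - e)%R 0%R.
have mh : measurable_fun setT h.
  by apply: measurable_maxr => //; apply: measurable_funB.
have h0 x : 0 <= (h x)%:E by rewrite lee_fin le_max lexx orbT.
apply: (@le_trans _ _ (\int[P]_x ((h x)%:E + (cst e%:E) x))).
  apply: lower_integral_le => x; first by rewrite lee_fin; exact: fun_ge0.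
  by rewrite -EFinD lee_fin -lerBlDr le_max lexx.
rewrite ge0_integralD //; last exact/measurable_EFinP.
have PT : P [set: T] = 1 := probability_setT P.
rewrite integral_cst // [X in e%:E * X]PT mule1 leeD2r //.
apply: lower_integral_le => // x; rewrite /h.
have [_|_] := leP (s x - e)%R 0%R; first exact: g0.
by rewrite EFinB leeBlDr // (le_trans (sf x)).
Qed.

(** The positive and negative parts each change by at most [e], hence the error [e + e]. The parts
    of [f] and [g] are infinite together, so infinite integrals agree as well. *)
Lemma integral_perturb X (f g : T -> R) (e : R) :
  (0 <= e)%R -> (forall x, X x -> (`|f x - g x| <= e)%R) ->
  \int[P]_(x in X) (f x)%:E <= \int[P]_(x in X) (g x)%:E + (e + e)%:E.
Proof.
move=> e0 fg.
have parts (u v : T -> R) : (forall x, X x -> (u x <= v x + e)%R) ->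
    \int[P]_(x in X) maxe (u x)%:E 0 <= \int[P]_(x in X) maxe (v x)%:E 0 + e%:E.
  move=> uv; rewrite integral_mkcond [X in _ <= X + _]integral_mkcond.
  have pos (w : T -> R) x : 0 <= ((fun y => maxe (w y)%:E 0) \_ X) x.
    by rewrite /patch; case: ifP => // _; rewrite le_max lexx orbT.
  apply: ge0_integral_perturb => // x; rewrite /patch; case: ifPn => [|_].
    rewrite inE => Xx; rewrite -!EFin_max -EFinD lee_fin ge_max.
    rewrite (le_trans (uv x Xx)) ?lerD2r ?le_max ?lexx //=.
    by rewrite addr_ge0 // le_max lexx orbT.
  by rewrite add0e lee_fin.
have int_ge0 (w : T -> R) : 0 <= \int[P]_(x in X) maxe (w x)%:E 0.
  by apply: integral_ge0 => x _; rewrite le_max lexx orbT.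
have E (w : T -> R) : \int[P]_(x in X) (w x)%:E =
    \int[P]_(x in X) maxe (w x)%:E 0 - \int[P]_(x in X) maxe (- w x)%:E 0.
  by rewrite integralE; congr (_ - _); apply: eq_integral => x _;
    rewrite (funeposE, funenegE).
have fg1 := parts f g; have fg2 := parts (fun x => - g x)%R (fun x => - f x)%R.
have gf1 := parts g f; have gf2 := parts (fun x => - f x)%R (fun x => - g x)%R.
have {}fg x : X x -> (f x <= g x + e /\ g x <= f x + e)%R.
  by move=> /fg; rewrite ler_norml => /andP[? ?]; split; lra.
have {}fg1 := fg1 (fun x Xx => (fg x Xx).1).
have {}gf1 := gf1 (fun x Xx => (fg x Xx).2).
have {fg2 gf2 parts} [fg2 gf2] : \int[P]_(x in X) maxe (- g x)%:E 0 <=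
      \int[P]_(x in X) maxe (- f x)%:E 0 + e%:E /\
    \int[P]_(x in X) maxe (- f x)%:E 0 <=
      \int[P]_(x in X) maxe (- g x)%:E 0 + e%:E.
  by split; [apply: fg2|apply: gf2] => x /fg[? ?]; lra.
have pf := int_ge0 f; have pg := int_ge0 g.
have nf := int_ge0 (fun x => - f x)%R; have ng := int_ge0 (fun x => - g x)%R.
rewrite !E; move: fg1 gf1 fg2 gf2 pf pg nf ng.
move: (\int[P]_(x in X) maxe (f x)%:E 0) (\int[P]_(x in X) maxe (g x)%:E 0).
move: (\int[P]_(x in X) maxe (- f x)%:E 0) (\int[P]_(x in X) maxe (- g x)%:E 0).
move=> [a| |] [b| |] [c| |] [u| |] //=; rewrite -?EFinD ?lee_fin //=.
by move=> *; lra.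
Qed.

End IntegralPerturbation.

End Perturbation.

(** * Convergence of the channels and of the risks *)

Section Limits.
Variables (R : realType) (dA dB : nat).
Local Notation C := R[i].
Local Open Scope complex_scope.
Variable T : forall m : nat, {linear 'M[C]_dA -> 'M[C]_(powdim m.+1 dB)}.
Variable Tlim : {linear 'M[C]_dA -> 'M[C]_dB}.
Hypothesis chT : forall m, is_channel (T m).
Hypothesis invT : forall m, perm_invariant (T m).
Hypothesis chlim : is_channel Tlim.

Let t m := trnorm (idtens (marginal ord0) (choi (T m)) - choi Tlim).
Hypothesis t0 : t m @[m --> \oo] --> (0 : R).

Let choi_le m i j : `|choi (marginal ord0 \o T m) i j - choi Tlim i j| <= (t m)%:C.
Proof.
by rewrite -choi_idtensE; have := trnorm_entry (idtens (marginal ord0)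
  (choi (T m)) - choi Tlim) i j; rewrite !mxE.
Qed.

Lemma limit_separable : separable (choi Tlim).
Proof.
apply: separable_closed => e e0.
have K0 : 0 <= 16 * dA%:R * dB%:R :> R by rewrite !mulr_ge0.
(* [d] makes the de Finetti error at most [e / 2], the other half being left for the convergence of
   the Choi matrices. The added 1 avoids a zero denominator, and [D] is the number of outputs that
   [d] requires. *)
pose d := e / 2 / (16 * dA%:R * dB%:R + 1).
have d0 : 0 < d by rewrite !divr_gt0 // ltr_wpDl.
pose D : R := #|{: bool * 'I_dA * 'I_dA}|%:R / d ^+ 2.
have [m [m0 mD tm]] : exists m, [/\ (0 < m)%N, D <= m%:R & t m <= e / 2].
  have e20 : 0 < e / 2 by rewrite divr_gt0.
  near \oo => m; exists m; split; near: m.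
  - exact: nbhs_infty_gt.
  - exact: nbhs_infty_ger.
  - have /cvgrPdist_le/(_ _ e20) := t0; apply: filterS => m.
    by rewrite sub0r normrN; apply: le_trans (ler_norm _).
have Dm : #|{: bool * 'I_dA * 'I_dA}|%:R <= d ^+ 2 * m%:R.
  by rewrite mulrC -ler_pdivrMr // exprn_gt0.
have [S [sepS SE]] := marginal_near_separable (chT m) (@invT m) d0 m0 Dm.
exists S; split=> // i j.
rewrite -[X in `|X|](subrKA (choi (marginal ord0 \o T m) i j)).
apply: le_trans (ler_normD _ _) _; rewrite [e]splitr rmorphD lerD //.
  by rewrite distrC (le_trans (choi_le m i j)) // lecR.
apply: le_trans (SE i j) _; rewrite lecR /d; move: K0; set k := 16 * _ * _ => K0.
have : 0 < e / 2 by rewrite divr_gt0.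
move: (e / 2) => a a0; rewrite mulrA ler_pdivrMr ?ltr_wpDl //.
by rewrite mulrC ler_wpM2l ?lerDl // ltW.
Unshelve. all: by end_near. Qed.

(** The two factors [dB] come from [trnorm_le]; the rest bounds the [dA * dA] terms of the expansion
    of the input, whose entries have modulus at most 2. *)
Let K : R := dB%:R * (dB%:R * (dA%:R * dA%:R * 2)).

Lemma output_le m Sigma : density Sigma ->
  trnorm (marginal ord0 (T m Sigma) - Tlim Sigma) <= K * t m.
Proof.
move=> dS; have entry x y :
    `|(marginal ord0 (T m Sigma) - Tlim Sigma) x y| <= (dA%:R * dA%:R * 2 * t m)%:C.
  have -> : (marginal ord0 (T m Sigma) - Tlim Sigma) x y = \sum_a \sum_b
      Sigma a b * (choi (marginal ord0 \o T m) (mxtens_index (a, x)) (mxtens_index (b, y))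
        - choi Tlim (mxtens_index (a, x)) (mxtens_index (b, y))).
    rewrite (linear_mx_sum (T m)) (linear_mx_sum Tlim).
    have sumE (I : Type) (r : seq I) (F : I -> 'M[C]_(powdim m.+1 dB)) :
        marginal ord0 (\sum_(i <- r) F i) = \sum_(i <- r) marginal ord0 (F i).
      exact: (big_morph _ (@marginalD R dB _ ord0) (@marginal0 _ _ _ _)).
    rewrite sumE -sumrB summxE; apply: eq_bigr => a _.
    rewrite sumE -sumrB summxE; apply: eq_bigr => b _.
    by rewrite marginalZ -scalerBr !choiE [LHS]mxE;
      congr (_ * _); rewrite [LHS]mxE; congr (_ + _); rewrite [LHS]mxE.
  apply: le_trans (ler_norm_sum _ _ _) _.
  rewrite -!mulrA mulr_natl rmorphMn -[X in _ *+ X](card_ord dA) -sumr_const ler_sum // => a _.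
  apply: le_trans (ler_norm_sum _ _ _) _.
  rewrite mulr_natl rmorphMn -[X in _ *+ X](card_ord dA) -sumr_const ler_sum // => b _.
  by rewrite normrM rmorphM /= rmorph_nat ler_pM // density_entry.
by apply: le_trans (trnorm_le entry) _; rewrite /K !mulrA.
Qed.

Variables (X : set 'M[C]_dA) (gamma : 'M[C]_dA -> 'M[C]_dB).
Variable L : 'M[C]_dB -> 'M[C]_dB -> R.
Hypothesis Xdensity : forall Sigma, X Sigma -> density Sigma.
Hypothesis wbL : well_behaved X gamma L.

Let margE m (i : 'I_m.+1) Sigma :
  marginal i (T m Sigma) = marginal ord0 (T m Sigma).
Proof. exact: marginal_perm. Qed.

Lemma loss_uniform_limit : exists e : nat -> R,
  [/\ e m @[m --> \oo] --> (0 : R), forall m, 0 <= e m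
    & forall m Sigma, X Sigma ->
      `|L (gamma Sigma) (marginal ord0 (T m Sigma)) - L (gamma Sigma) (Tlim Sigma)|
        <= e m].
Proof.
(* The absolute value makes the bound nonnegative and monotone in the trace norm whatever the sign
   of [L0]. It does not depend on [Sigma]. *)
have [L0 L0P] := wbL; exists (fun m => `|L0| * (K * t m)).
have t_ge0 m : 0 <= t m by exact: trnorm_ge0.
split=> [|m|m Sigma XS].
- rewrite -[X in _ --> X](mulr0 `|L0|) -[X in _ * X](mulr0 K).
  by apply: cvgMl_tmp; apply: cvgMl_tmp.
- by rewrite !mulr_ge0.
have dS := Xdensity XS.
apply: le_trans (L0P _ _ _ XS _ _) _.
- by apply/density_marginal/channel_density.
- exact: channel_density.
apply: le_trans (_ : _ <= `|L0| * trnorm (marginal ord0 (T m Sigma) - Tlim Sigma)) _.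
  by rewrite ler_wpM2r ?trnorm_ge0 // ler_norm.
by rewrite ler_wpM2l // output_le.
Qed.

Lemma worst_one_riskE m : worst_one_risk X gamma L (T m)
  = worst_risk X gamma L (marginal ord0 \o T m).
Proof.
rewrite /worst_one_risk; congr (ereal_sup [set _ | _ in X]); apply/funext => Sigma.
congr EFin; under eq_bigr do rewrite margE.
by elim/big_rec: _ => // i c _ ->; rewrite minxx.
Qed.

Lemma average_one_riskE G (pi : probability (g_sigma_algebraType G) R) m :
  average_one_risk X gamma L pi (T m)
  = average_risk X gamma L pi (marginal ord0 \o T m).
Proof.
rewrite /average_one_risk; apply: eq_integral => Sigma _; congr EFin.
under eq_bigr do rewrite margE.
by rewrite sumr_const card_ord -[X in _ * X]mulr_natl mulKf ?pnatr_eq0.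
Qed.

Lemma worst_risk_limit :
  worst_one_risk X gamma L (T m) @[m --> \oo] --> worst_risk X gamma L Tlim.
Proof.
have [e [e0 e_ge0 eL]] := loss_uniform_limit.
apply: (ereal_perturb_cvg e0) => m; rewrite worst_one_riskE;
  apply: ereal_sup_perturb => Sigma XS; have := eL m Sigma XS;
  rewrite ler_norml /= => /andP[? ?]; lra.
Qed.

Lemma average_risk_limit G (pi : probability (g_sigma_algebraType G) R) :
  average_one_risk X gamma L pi (T m) @[m --> \oo]
    --> average_risk X gamma L pi Tlim.
Proof.
have [e [e0 e_ge0 eL]] := loss_uniform_limit.
have ee0 : e m + e m @[m --> \oo] --> (0 : R).
  by rewrite -[X in _ --> X]addr0; apply: cvgD.
apply: (ereal_perturb_cvg ee0) => m; rewrite average_one_riskE;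
  apply: integral_perturb => // Sigma XS; [|rewrite distrC]; exact: eL.
Qed.

End Limits.

(* T m is the protocol with m.+1 outputs. *)
Theorem theoremS2p2 (R : realType) (dA dB : nat)
    (X : set 'M[R[i]]_dA) (gamma : 'M[R[i]]_dA -> 'M[R[i]]_dB)
    (L : 'M[R[i]]_dB -> 'M[R[i]]_dB -> R)
    (T : forall m : nat, {linear 'M[R[i]]_dA -> 'M[R[i]]_(powdim m.+1 dB)})
    (Tlim : {linear 'M[R[i]]_dA -> 'M[R[i]]_dB}) :
  (forall Sigma, X Sigma -> density Sigma) ->
  (forall Sigma, X Sigma -> density (gamma Sigma)) ->
  well_behaved X gamma L ->
  (forall m, is_channel (T m)) ->
  (forall m, exchange_invariant (T m) \/ bosonic (T m)) ->
  is_channel Tlim ->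
  trnorm (idtens (marginal ord0) (choi (T m)) - choi Tlim) @[m --> \oo]
    --> (0 : R) ->
  [/\ entanglement_breaking Tlim,
      worst_one_risk X gamma L (T m) @[m --> \oo] --> worst_risk X gamma L Tlim
    & forall (G : set (set 'M[R[i]]_dA))
             (pi : probability (g_sigma_algebraType G) R),
        G.-sigma.-measurable X -> pi X = 1%E ->
        average_one_risk X gamma L pi (T m) @[m --> \oo]
          --> average_risk X gamma L pi Tlim].
Proof.
move=> Xdensity _ wbL chT symT chlim t0.
have invT m : perm_invariant (T m).
  case: (symT m); first exact: exchange_perm_invariant.
  by apply: bosonic_perm_invariant; case: (chT m).
split=> [||G pi _ _].
- by split=> //; apply: limit_separable t0.
- exact: (worst_risk_limit chT invT chlim t0 Xdensity wbL).
- exact: (average_risk_limit chT invT chlim t0 Xdensity wbL).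
Qed.
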